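(* Let $W\in\mathbb{R}^{n\times n}$ be nonnegative, primitive and column-stochastic, with equilibrium vector $\pi$, $\beta_\pi=\|W-\pi\mathbb 1_n^\top\|_\pi$ and $\kappa_\pi=\max_i\pi_i/\min_i\pi_i$. Let $L,\Delta>0$, $\sigma\ge0$. Suppose each $f_i:\mathbb{R}^d\to\mathbb{R}$ has $L$-Lipschitz gradient, $f=\frac1n\sum_{i=1}^n f_i$ satisfies $f(x^{(0)})-\inf_x f(x)\le\Delta$, and the stochastic gradients are unbiased with variance at most $\sigma^2$. Run Push-DIGing for $K\ge1$ iterations from $x_i^{(0)}=x^{(0)}$ for all $i$, with step-size $\gamma=\big(\sum_{i=1}^6\gamma_i^{-1}\big)^{-1}$, where $$\gamma_1=\Big(\tfrac{2n\Delta}{(K+1)L\sigma^2}\Big)^{1/2},\quad \gamma_2=\Big(\tfrac{\Delta(1-\beta_\pi)^3}{2(K+1)L^2\kappa_\pi^6\beta_\pi^4\sigma^2}\Big)^{1/3},\quad \gamma_3=\Big(\tfrac{n^2\Delta(1-\beta_\pi)^4}{1200(K+1)L^4\kappa_\pi^8\beta_\pi^4\sigma^2}\Big)^{1/5},$$ $$\gamma_4=\Big(\tfrac{(1-\beta_\pi)^2\Delta}{4L^2\kappa_\pi^4\beta_\pi^2\,\mathbb{E}[\|\mathbf y^{(0)}\|_F^2]}\Big)^{1/3},\quad \gamma_5=\tfrac{(1-\beta_\pi)^2}{40L\kappa_\pi^7\beta_\pi},\quad \gamma_6=\tfrac1{2L},$$ with the convention $\gamma_i^{-1}=0$ when the denominator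 in $\gamma_i$ vanishes. Then there is a constant $C$ depending only on $L$, $\Delta$ and $\mathbb{E}[\|\mathbf y^{(0)}\|_F^2]$ (and not on $n,K,\sigma,\beta_\pi,\kappa_\pi$) such that $$\frac1{K+1}\sum_{k=0}^K\mathbb{E}\big[\|\nabla f(\bar x^{(k)})\|_2^2\big]\le C\left(\frac{\sigma}{\sqrt{nK}}+\frac{\beta_\pi^{4/3}\kappa_\pi^2\sigma^{2/3}}{(1-\beta_\pi)K^{2/3}}+\frac{\kappa_\pi^7\beta_\pi}{(1-\beta_\pi)^2K}+\frac1K\right).$$
   Context: Mixing matrix: $W$ is column-stochastic if $\mathbb 1_n^\top W=\mathbb 1_n^\top$ ($\mathbb 1_n$ the all-ones vector). The equilibrium vector $\pi$ is the unique vector with positive entries, $W\pi=\pi$, $\mathbb 1_n^\top\pi=1$. $\|A\|_\pi:=\|\mathrm{diag}(\sqrt\pi)^{-1}A\,\mathrm{diag}(\sqrt\pi)\|_2$ for $A\in\mathbb{R}^{n\times n}$; one has $\beta_\pi\in[0,1)$. Stochastic gradients: node $i$ has an oracle $\nabla F(x;\xi_i)$ with $\mathbb{E}[\nabla F(x;\xi_i)]=\nabla f_i(x)$ and $\mathbb{E}\|\nabla F(x;\xi_i)-\nabla f_i(x)\|^2\le\sigma^2$ for all $x$; the samples $\xi_i^{(k)}$ are independent across nodes $i$ and iterations $k$. Push-DIGing: for $\mathbf x\in\mathbb{R}^{n\times d}$ with rows $x_1^\top,\dots,x_n^\top$, let $\nabla F(\mathbf x;\boldsymbol\xi)\in\mathbb{R}^{n\times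 d}$ have $i$-th row $\nabla F(x_i;\xi_i)^\top$. Initialize $\mathbf w^{(0)}=\mathbf x^{(0)}$ (all rows equal to $(x^{(0)})^\top$), $\mathbf y^{(0)}=\nabla F(\mathbf x^{(0)};\boldsymbol\xi^{(0)})$, $v^{(0)}=\mathbb 1_n$, and for $k\ge0$ $$\mathbf x^{(k+1)}=W(\mathbf x^{(k)}-\gamma\mathbf y^{(k)}),\quad v^{(k+1)}=Wv^{(k)},\quad V^{(k+1)}=\mathrm{diag}(v^{(k+1)}),\quad \mathbf w^{(k+1)}=(V^{(k+1)})^{-1}\mathbf x^{(k+1)},$$ $$\mathbf y^{(k+1)}=W\big(\mathbf y^{(k)}+\nabla F(\mathbf w^{(k+1)};\boldsymbol\xi^{(k+1)})-\nabla F(\mathbf w^{(k)};\boldsymbol\xi^{(k)})\big).$$ $\bar x^{(k)}=\frac1n\sum_i x_i^{(k)}$, where $(x_i^{(k)})^\top$ is the $i$-th row of $\mathbf x^{(k)}$. *)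

(* Defs.v *)
From mathcomp Require Import all_boot all_order all_algebra finmap.
From mathcomp Require Import all_classical all_reals all_analysis.

Set Implicit Arguments.
Unset Strict Implicit.
Unset Printing Implicit Defensive.

Import Order.TTheory GRing.Theory Num.Theory.
Import numFieldNormedType.Exports.

Local Open Scope classical_set_scope.
Local Open Scope ring_scope.

Section Norms.
Variable R : realType.

(* Frobenius norm; on row and column vectors this is the Euclidean norm (the
   library norm `|A| on matrices is the entrywise maximum norm). *)
Definition sqnorm m n (A : 'M[R]_(m, n)) : R := \sum_i \sum_j A i j ^+ 2.
Definition l2norm m n (A : 'M[R]_(m, n)) : R := Num.sqrt (sqnorm A).

Definition spectral_norm n (A : 'M[R]_n) : R :=
  sup [set l2norm (A *m x) | x in [set x : 'cV[R]_n | l2norm x <= 1]].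

End Norms.

Section MixingMatrix.
Variables (R : realType) (n : nat).
Implicit Types (W A : 'M[R]_n) (pi : 'cV[R]_n).

Definition nonnegative_mx W : Prop := forall i j, 0 <= W i j.

Definition primitive_mx W : Prop :=
  exists2 m : nat, (0 < m)%N & forall i j, 0 < (W ^+ m) i j.

Definition column_stochastic W : Prop :=
  (const_mx 1 : 'rV[R]_n) *m W = const_mx 1.

(* For a nonnegative, primitive, column-stochastic W such a vector is unique. *)
Definition is_equilibrium W pi : Prop :=
  [/\ forall i, 0 < pi i 0, W *m pi = pi & (const_mx 1 : 'rV[R]_n) *m pi = 1].

Definition pi_norm pi A : R :=
  let D := diag_mx (map_mx Num.sqrt pi^T) in
  spectral_norm (invmx D *m A *m D).

(* beta_pi W pi is at most 1 for a nonnegative column-stochastic W, but primitivity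
   alone does not exclude beta_pi W pi = 1 (e.g. columns e2, e3, (e1 + e2) / 2),
   so beta_pi < 1 has to be stated wherever 1 - beta_pi is divided by. *)
Definition beta_pi W pi : R := pi_norm pi (W - pi *m (const_mx 1 : 'rV[R]_n)).

(* The two seeds make these the maximum and minimum of the entries of a vector
   with positive entries and n > 0. *)
Definition max_entry pi : R := \big[Num.max/0]_i pi i 0.
Definition min_entry pi : R := \big[Num.min/max_entry pi]_i pi i 0.

Definition kappa_pi pi : R := max_entry pi / min_entry pi.

End MixingMatrix.

Section Objective.
Variables (R : realType) (d : nat).
Implicit Types (f : 'rV[R]_d -> R) (x : 'rV[R]_d).

Definition grad f x : 'rV[R]_d := \row_j 'D_(delta_mx 0 j) f x.

Definition lipschitz_gradient (L : R) f : Prop :=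
  (forall x, differentiable f x) /\
  (forall x y, l2norm (grad f x - grad f y) <= L * l2norm (x - y)).

Definition average n (f : 'I_n -> 'rV[R]_d -> R) x : R :=
  n%:R^-1 * \sum_i f i x.

End Objective.

Section Randomness.

Definition mutually_independent d d' (T : measurableType d) (R : realType)
    (P : probability T R) (I : choiceType) (E : I -> measurableType d')
    (X : forall i, {RV P >-> E i}) : Prop :=
  forall (J : {fset I}) (A : forall i, set (E i)),
    (forall i, measurable (A i)) ->
    P (\bigcap_(i in [set` J]) (X i @^-1` A i)) =
    (\prod_(i <- J) P (X i @^-1` A i))%E.

(* Joint measurability in the point and the sample, where R^d carries its
   product (= Borel) sigma-algebra, which the library puts on tuples. *)
Definition measurable_oracle dX (X : measurableType dX) (R : realType) (d : nat)
    (G : 'rV[R]_d -> X -> 'rV[R]_d) : Prop :=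
  forall j, measurable_fun [set: d.-tuple R * X]
    (fun p => G (\row_l tnth p.1 l) p.2 0 j).

Definition stoch_grad dX (R : realType) (n d : nat)
    (X : 'I_n -> measurableType dX) (G : forall i, 'rV[R]_d -> X i -> 'rV[R]_d)
    (s : forall i, X i) (x : 'M[R]_(n, d)) : 'M[R]_(n, d) :=
  \matrix_(i, j) G i (row i x) (s i) 0 j.

End Randomness.

Section PushDIGing.
Variables (R : realType) (n d : nat).

Record pd_state := PDState {
  pd_x : 'M[R]_(n, d);
  pd_y : 'M[R]_(n, d);
  pd_v : 'cV[R]_n;
  pd_w : 'M[R]_(n, d) }.

Definition all_rows (x0 : 'rV[R]_d) : 'M[R]_(n, d) := \matrix_i x0.

Definition row_mean (x : 'M[R]_(n, d)) : 'rV[R]_d :=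
  n%:R^-1 *: \sum_i row i x.

(* g k is the stochastic gradient map of iteration k. *)
Variables (W : 'M[R]_n) (gamma : R) (x0 : 'rV[R]_d).
Variable g : nat -> 'M[R]_(n, d) -> 'M[R]_(n, d).

Definition pd_init : pd_state :=
  PDState (all_rows x0) (g 0%N (all_rows x0)) (const_mx 1) (all_rows x0).

Definition pd_step (k : nat) (s : pd_state) : pd_state :=
  let x' := W *m (pd_x s - gamma *: pd_y s) in
  let v' := W *m pd_v s in
  let w' := invmx (diag_mx v'^T) *m x' in
  let y' := W *m (pd_y s + g k.+1 w' - g k (pd_w s)) in
  PDState x' y' v' w'.

Fixpoint push_diging (k : nat) : pd_state :=
  if k is k'.+1 then pd_step k' (push_diging k') else pd_init.

End PushDIGing.

(* A vanishing denominator makes gammaX equal to 0 and hence gammaX^-1 = 0,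
   since 0^-1 = 0 and 0 `^ r = 0 for r != 0: this is exactly the convention that
   the corresponding summand of the step size is dropped.
   Y stands for the expected squared Frobenius norm of y^(0). *)
Section StepSize.
Variables (R : realType) (n K : nat) (L Delta sigma beta kappa Y : R).

Definition gamma1 : R :=
  (2 * n%:R * Delta / (K.+1%:R * L * sigma ^+ 2)) `^ (1 / 2).
Definition gamma2 : R :=
  (Delta * (1 - beta) ^+ 3 /
   (2 * K.+1%:R * L ^+ 2 * kappa ^+ 6 * beta ^+ 4 * sigma ^+ 2)) `^ (1 / 3).
Definition gamma3 : R :=
  (n%:R ^+ 2 * Delta * (1 - beta) ^+ 4 /
   (1200 * K.+1%:R * L ^+ 4 * kappa ^+ 8 * beta ^+ 4 * sigma ^+ 2)) `^ (1 / 5).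
Definition gamma4 : R :=
  ((1 - beta) ^+ 2 * Delta /
   (4 * L ^+ 2 * kappa ^+ 4 * beta ^+ 2 * Y)) `^ (1 / 3).
Definition gamma5 : R := (1 - beta) ^+ 2 / (40 * L * kappa ^+ 7 * beta).
Definition gamma6 : R := 1 / (2 * L).

Definition step_size : R :=
  (gamma1^-1 + gamma2^-1 + gamma3^-1 + gamma4^-1 + gamma5^-1 + gamma6^-1)^-1.

Definition rate : R :=
  sigma / Num.sqrt (n%:R * K%:R)
  + beta `^ (4 / 3) * kappa ^+ 2 * sigma `^ (2 / 3)
    / ((1 - beta) * K%:R `^ (2 / 3))
  + kappa ^+ 7 * beta / ((1 - beta) ^+ 2 * K%:R)
  + 1 / K%:R.

End StepSize.

(* Main.v *)
(* Let B = W - pi 1^T, which contracts the norm weighted by 1/pi by the factor beta.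
   The deviation x - v xbar solves a linear recursion driven by B, whose solution is
   explicit: consecutive stochastic gradient differences enter it through the kernel
   m |-> m * B^(m+1).  Splitting each stochastic gradient into gradient and noise, the
   gradient part is absorbed by the step-size conditions gamma5 and gamma6 (Young's
   convolution inequality), while the noises are pairwise orthogonal in L^2, so only
   the squares of the kernel count, which gives (1 - beta)^-3 instead of (1 - beta)^-4.
   Summing the descent lemma along xbar then yields, pathwise, a bound on the squared
   gradients whose expectation is
     2 Delta / (gamma (K+1)) + 4 gamma L sigma^2 / n
       + 36 (gamma L)^2 kappa^3 beta^4 sigma^2 / (1 - beta)^3 + Y / (K+1);
   the initial tracking error Y is dominated using gamma5 alone, and inserting the six
   summands of 1 / gamma gives the rate.  Orthogonality of the noise comes from the
   independence of a sample from the sigma-algebra of all earlier ones together with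
   Fubini's theorem for their joint law. *)
From HB Require Import structures.
Require Import Defs.
From mathcomp Require Import all_boot all_order all_algebra finmap.
From mathcomp Require Import all_classical all_reals all_analysis measurable_realfun.
From mathcomp Require Import ring lra.
Import Order.TTheory GRing.Theory Num.Theory.
Import numFieldNormedType.Exports.
Local Open Scope classical_set_scope.
Local Open Scope ring_scope.

Set Implicit Arguments.
Unset Strict Implicit.
Unset Printing Implicit Defensive.

(** * Independence *)

(** The consensus error feeds on itself: the gradient differences that drive the deviation are
    controlled by the deviation at neighbouring times. Its bound is therefore implicit, and the
    smallness of gamma5 is what closes it. The factor m in the kernel records that each difference
    is filtered twice through B, once inside [y] and once more when [y] moves [x]. Noise differences
    are not orthogonal among themselves, because neighbouring ones share a sample. They are taken
    apart into two sequences, the noise at j + 1 and the noise at j, each of which is orthogonal on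
    its own. The iterates are random points produced by earlier samples, whereas unbiasedness and
    the variance bound are given at deterministic points. A freezing argument leads from one to the
    other: the new sample is integrated out while the past is held at a fixed value. For this every
    iterate must be measurable with respect to the samples it is made of, and square integrable. *)

Section Independence.
Context {dT dE : measure_display} {T : measurableType dT} {R : realType}.
Context {P : probability T R} {I : choiceType} {E : I -> measurableType dE}.
Context {X : forall i, {RV P >-> E i}}.

(** A pi-system that generates the sigma-algebra of the samples indexed by [S]. Its members involve
    finitely many indices because mutual independence speaks of finite families. *)
Definition cylinders (S : set I) : set (set T) :=
  [set A | exists (J : {fset I}) (B : forall i, set (E i)),
    [/\ forall i, i \in J -> S i, forall i, measurable (B i) &
        A = \bigcap_(i in [set` J]) (X i @^-1` B i)]].

Lemma cylindersT S : cylinders S setT.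
Proof.
exists fset0, (fun=> setT); split => //.
by apply/seteqP; split => // t _ i.
Qed.

Lemma cylindersI S : setI_closed (cylinders S).
Proof.
move=> _ _ [J [B [JS mB ->]]] [J' [B' [JS' mB' ->]]].
exists (J `|` J')%fset, (fun i => (if i \in J then B i else setT) `&`
  (if i \in J' then B' i else setT)); split.
- by move=> i; rewrite inE => /orP[/JS|/JS'].
- by move=> i; apply: measurableI; case: ifP.
- apply/seteqP; split => [t [tB tB'] i /= _|t tBB'].
    by split; case: ifPn => // iJ; [exact: tB|exact: tB'].
  split => i /= iJ.
    by have := tBB' i; rewrite /= inE iJ => /(_ isT)[].
  by have := tBB' i; rewrite /= inE iJ orbT => /(_ isT)[_].
Qed.

Lemma sub_cylinders_measurable S : <<s cylinders S >> `<=` measurable.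
Proof.
apply: smallest_sub; first exact: sigma_algebra_measurable.
move=> _ [J [B [_ mB ->]]].
have -> : \bigcap_(i in [set` J]) (X i @^-1` B i) =
    \big[setI/setT]_(i <- J) (X i @^-1` B i) by rewrite bigcap_fset.
by apply: big_ind => // [|i _]; [exact: measurableI|exact: measurable_funPTI].
Qed.

Lemma sub_cylinders S S' : S `<=` S' -> cylinders S `<=` cylinders S'.
Proof.
by move=> SS' _ [J [B [JS mB ->]]]; exists J, B; split => // i /JS /SS'.
Qed.

Hypothesis indep : mutually_independent X.

(** For fixed [B] both sides are finite measures in [A], a restriction of P and a multiple of P.
    Independence makes them agree on the pi-system of cylinders, and uniqueness of measures extends
    this to the generated sigma-algebra. *)
Lemma indep_event S i0 A B : ~ S i0 -> <<s cylinders S >> A ->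
  measurable B -> P (A `&` X i0 @^-1` B) = (P A * P (X i0 @^-1` B))%E.
Proof.
move=> Si0 SA mB.
have mX : measurable (X i0 @^-1` B) by exact: measurable_funPTI.
have c0 : 0 <= fine (P (X i0 @^-1` B)) by apply: fine_ge0.
pose m1 : {measure set T -> \bar R} := mrestr P mX.
pose m2 : {measure set T -> \bar R} := mscale (NngNum c0) P.
have H := @g_sigma_algebra_measure_unique _ R T (cylinders S) _
  (fun=> setT) (fun=> cylindersT S) _ m1 m2 (@cylindersI S).
have : m1 A = m2 A.
  apply: H => //.
  - exact: subset_trans (@sub_gen_smallest _ _ _) (@sub_cylinders_measurable S).
  - by rewrite bigcup_const.
  - move=> _ [J [C [JS mC ->]]].
    rewrite /m1 /m2 /= /mrestr /mscale /= fineK ?fin_num_measure//.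
    have i0J : i0 \notin J by apply/negP => /JS.
    (* Independence is used for [J] and again for [J] enlarged by [i0]; [dfwith] places [B] at [i0]
       and leaves the other events as they are. *)
    rewrite indep//.
    have := @indep (i0 |` J)%fset (dfwith C i0 B).
    rewrite big_fsetU1//= dfwithin (eq_big_seq (fun i => P (X i @^-1` C i))).
      move=> <-; last by move=> i; case: dfwithP.
    2: { move=> i iJ /=; rewrite dfwithout//.
      by apply: contraNN i0J => /eqP ->. }
    congr (P _); apply/seteqP; split => [t [tC tB] i /=|t tC].
      rewrite !inE => /predU1P[->|iJ]; first by rewrite dfwithin.
      rewrite dfwithout; first exact: tC.
      by apply: contraNN i0J => /eqP ->.
    split; last by have := tC i0; rewrite /= !inE eqxx dfwithin; exact.
    move=> i /= iJ; have := tC i; rewrite /= !inE iJ orbT dfwithout; first exact.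
    by apply: contraNN i0J => /eqP ->.
  - by move=> _; rewrite /m1 /= /mrestr setTI ltey_eq fin_num_measure.
rewrite /m1 /m2 /= /mrestr /mscale /= => ->.
by rewrite fineK ?fin_num_measure// muleC.
Qed.

(** The points of [T] under a coarser sigma-algebra, so that being determined by the samples in [S]
    becomes ordinary measurability on another domain. *)
Definition past (S : set I) := g_sigma_algebraType (cylinders S).

Lemma past_measurable_fun S d' (T' : measurableType d') (Y : T -> T') :
  measurable_fun (setT : set (past S)) Y -> measurable_fun setT Y.
Proof.
by move=> mY _ B mB; apply: sub_cylinders_measurable; exact: (mY measurableT B mB).
Qed.

Lemma past_sub S S' d' (T' : measurableType d') (Y : T -> T') : S `<=` S' ->
  measurable_fun (setT : set (past S)) Y -> measurable_fun (setT : set (past S')) Y.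
Proof.
move=> SS' mY _ B mB; rewrite setTI.
have := mY measurableT B mB; rewrite setTI.
apply: sub_smallest2r; first exact: smallest_sigma_algebra.
exact: sub_cylinders.
Qed.

Lemma past_measurable_RV S i : S i -> measurable_fun (setT : set (past S)) (X i).
Proof.
move=> Si _ B mB; rewrite setTI; apply: sub_gen_smallest.
exists [fset i]%fset, (dfwith (fun=> setT) i B); split.
- by move=> j; rewrite inE => /eqP ->.
- by move=> j; case: dfwithP.
- apply/seteqP; split => [t tB j /=|t].
    by rewrite inE => /eqP ->; rewrite dfwithin.
  by move=> /(_ i); rewrite /= inE eqxx dfwithin => /(_ isT).
Qed.

(** * Joint law of the past and a new sample *)

Section ProductLaw.
Context {dY : measure_display} {TY : measurableType dY}.
Variables (S : set I) (i0 : I) (Y : T -> TY).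
Hypothesis Si0 : ~ S i0.
Hypothesis mY : measurable_fun (setT : set (past S)) Y.

Let mYT : measurable_fun setT Y := past_measurable_fun mY.
HB.instance Definition _ := isMeasurableFun.Build _ _ _ _ Y mYT.

Let YX : T -> TY * E i0 := fun t => (Y t, X i0 t).
Let mYX : measurable_fun setT YX.
Proof. by apply/measurable_fun_pair => //; exact: measurable_funP. Qed.
HB.instance Definition _ := isMeasurableFun.Build _ _ _ _ YX mYX.

Let joint_law Z : measurable Z ->
  (distribution P Y \x distribution P (X i0))%E Z = distribution P YX Z.
Proof.
apply: (@product_measure_unique _ _ _ _ _ _ _ (distribution P YX)) => A B mA mB.
rewrite /distribution /= /pushforward.
rewrite -(@indep_event S)//.
by have := mY measurableT mA; rewrite setTI.
Qed.

(** Freezing: the joint law is a product, so Tonelli integrates over the new sample with the past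
    held at a value [y], and a bound uniform in [y] survives averaging over the past. This plays the
    part of a conditional expectation. *)
Lemma indep_integral_le (f : TY * E i0 -> \bar R) (c : R) :
  measurable_fun [set: TY * E i0] f -> (forall z, 0 <= f z)%E ->
  (forall y, \int[P]_u f (y, X i0 u) <= c%:E)%E ->
  (\int[P]_t f (Y t, X i0 t) <= c%:E)%E.
Proof.
move=> mf f0 fc.
have -> : (\int[P]_t f (Y t, X i0 t) = \int[distribution P YX]_z f z)%E.
  by rewrite ge0_integral_distribution.
rewrite (eq_measure_integral (distribution P Y \x distribution P (X i0))%E); last first.
  by move=> Z mZ _; exact/esym/joint_law.
rewrite fubini_tonelli1//= -[leRHS]mule1.
rewrite -(@probability_setT _ _ _ (distribution P Y)) -integral_cst//.
apply: ge0_le_integral => //.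
- by move=> y _; exact: integral_ge0.
- exact: measurable_fun_fubini_tonelli_F.
- move=> y _; rewrite /fubini_F ge0_integral_distribution//; first exact: fc.
  exact: measurableT_comp.
Qed.

(** For a signed integrand Fubini asks for integrability under the product law; it is transported
    from the composed variable by applying Tonelli to the absolute value. *)
Lemma indep_integral0 (f : TY * E i0 -> \bar R) :
  measurable_fun [set: TY * E i0] f -> P.-integrable setT (fun t => f (Y t, X i0 t)) ->
  (forall y, P.-integrable setT (fun u => f (y, X i0 u))) ->
  (forall y, \int[P]_u f (y, X i0 u) = 0)%E ->
  (\int[P]_t f (Y t, X i0 t) = 0)%E.
Proof.
move=> mf intf intfy f0.
transitivity (\int[distribution P YX]_z f z)%E.
  by rewrite integral_distribution.
rewrite (eq_measure_integral (distribution P Y \x distribution P (X i0))%E); last first.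
  by move=> Z mZ _; exact/esym/joint_law.
rewrite -integral12_prod_meas1; last first.
  apply/integrable12ltyP => //.
  rewrite -(@fubini_tonelli1 _ _ _ _ _ _ _ (abse \o f))//=; last first.
    exact: measurableT_comp.
  rewrite (eq_measure_integral (distribution P YX)); last first.
    by move=> Z mZ _; exact: joint_law.
  rewrite ge0_integral_distribution//; last exact: measurableT_comp.
  by have /integrableP[] := intf.
rewrite (eq_integral (cst 0%E)) ?integral0// => y _.
rewrite /fubini_F integral_distribution; [exact: f0| |exact: intfy].
exact: measurableT_comp.
Qed.

End ProductLaw.
End Independence.

(** * Square-integrable random variables *)

Lemma sqnorm_ge0 (R : realType) m n (A : 'M[R]_(m, n)) : 0 <= sqnorm A.
Proof. by apply: sumr_ge0 => i _; apply: sumr_ge0 => j _; exact: sqr_ge0. Qed.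

Section SquareIntegrable.
Context {d : measure_display} {T : measurableType d} {R : realType}.
Variable P : probability T R.
Implicit Types f g h : T -> R.

Lemma expectationE f : 'E_P[f]%E = (\int[P]_t (f t)%:E)%E.
Proof. by rewrite unlock. Qed.

Definition integ f := P.-integrable setT (fun t => (f t)%:E).

(** Membership in L^2. Measurability of [f] is a separate clause because it does not follow from
    that of the square. *)
Definition sqint f := measurable_fun setT f /\ integ (fun t => f t ^+ 2).

Lemma eq_RintegralT g f : {in setT, f =1 g} -> \int[P]_t f t = \int[P]_t g t.
Proof. exact: eq_Rintegral. Qed.

Lemma eq_integ f g : f =1 g -> integ f -> integ g.
Proof. by move=> /funext ->. Qed.

Lemma integ_le f g : measurable_fun setT f -> (forall t, `|f t| <= g t) ->
  integ g -> integ f.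
Proof.
move=> mf fg; apply: le_integrable => //; first exact/measurable_EFinP.
by move=> t _; rewrite /= lee_fin (le_trans (fg t))// ler_norm.
Qed.

Lemma integ_cst c : integ (fun=> c).
Proof. exact: finite_measure_integrable_cst. Qed.

Lemma Rintegral_cst_probability c : \int[P]_t c = c.
Proof.
rewrite Rintegral_cst//.
suff -> : fine (P setT) = 1 by rewrite mulr1.
by rewrite probability_setT.
Qed.

Lemma integD f g : integ f -> integ g -> integ (fun t => f t + g t).
Proof. by move=> If Ig; apply: (integrableD _ If Ig). Qed.

Lemma integZ c f : integ f -> integ (fun t => c * f t).
Proof. by move=> If; apply: (integrableZl _ c If). Qed.

Lemma integB f g : integ f -> integ g -> integ (fun t => f t - g t).
Proof. by move=> If Ig; apply: (integrableB _ If Ig). Qed.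

Lemma integ_sum (I : Type) (r : seq I) (Q : pred I) (F : I -> T -> R) :
  (forall i, Q i -> integ (F i)) -> integ (fun t => \sum_(i <- r | Q i) F i t).
Proof.
move=> IF; rewrite /integ; under eq_fun do rewrite -sumEFin.
exact: integrable_sum.
Qed.

Lemma Rintegral_sum (I : Type) (r : seq I) (Q : pred I) (F : I -> T -> R) :
  (forall i, Q i -> integ (F i)) ->
  \int[P]_t (\sum_(i <- r | Q i) F i t) = \sum_(i <- r | Q i) \int[P]_t F i t.
Proof.
move=> IF; elim: r => [|i r IH].
  by rewrite big_nil; under eq_Rintegral do rewrite big_nil; rewrite Rintegral_cst// mul0r.
rewrite big_cons; under eq_Rintegral do rewrite big_cons.
case: ifPn => Qi; last exact: IH.
by rewrite RintegralD// ?IH//; [exact: IF|exact: integ_sum].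
Qed.

Lemma Rintegral_fineK f : integ f -> (\int[P]_t f t)%:E = (\int[P]_t (f t)%:E)%E.
Proof. by move=> If; rewrite fineK// integrable_fin_num. Qed.

Lemma eq_sqint f g : f =1 g -> sqint f -> sqint g.
Proof. by move=> /funext ->. Qed.

Lemma sqint_le f g : measurable_fun setT f -> (forall t, f t ^+ 2 <= g t) ->
  integ g -> sqint f.
Proof.
move=> mf fg Ig; split => //; apply: integ_le Ig; first exact: measurable_funX.
by move=> t; rewrite ger0_norm ?sqr_ge0.
Qed.

Lemma integM f g : sqint f -> sqint g -> integ (fun t => f t * g t).
Proof.
move=> [mf If] [mg Ig].
apply: (@integ_le _ (fun t => f t ^+ 2 + g t ^+ 2)).
- exact: measurable_funM.
- by move=> t; rewrite ler_norml; apply/andP; split; nra.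
- exact: integD.
Qed.

Lemma sqint_cst c : sqint (fun=> c).
Proof. by split; [exact: measurable_cst|exact: integ_cst]. Qed.

Lemma sqint_integ f : sqint f -> integ f.
Proof.
move=> Sf; apply: eq_integ (integM Sf (sqint_cst 1)).
by move=> t; rewrite mulr1.
Qed.

Lemma sqintD f g : sqint f -> sqint g -> sqint (fun t => f t + g t).
Proof.
move=> [mf If] [mg Ig].
apply: (@sqint_le _ (fun t => 2 * (f t ^+ 2 + g t ^+ 2))).
- exact: measurable_funD.
- by move=> t; have := sqr_ge0 (f t - g t); nra.
- exact/integZ/integD.
Qed.

Lemma sqintZ c f : sqint f -> sqint (fun t => c * f t).
Proof.
move=> [mf If]; apply: (@sqint_le _ (fun t => c ^+ 2 * f t ^+ 2)).
- exact: measurable_funM.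
- by move=> t; rewrite exprMn.
- exact: integZ.
Qed.

Lemma sqint_sum (I : Type) (r : seq I) (Q : pred I) (F : I -> T -> R) :
  (forall i, Q i -> sqint (F i)) -> sqint (fun t => \sum_(i <- r | Q i) F i t).
Proof.
move=> SF; elim: r => [|i r IH].
  by apply: eq_sqint (sqint_cst 0) => t; rewrite big_nil.
have [Qi|Qi] := boolP (Q i).
  by apply: eq_sqint (sqintD (SF _ Qi) IH) => t; rewrite big_cons Qi.
by apply: eq_sqint IH => t; rewrite big_cons (negbTE Qi).
Qed.

Lemma integ_sqnorm m n (F : T -> 'M[R]_(m, n)) :
  (forall i j, sqint (fun t => F t i j)) -> integ (fun t => sqnorm (F t)).
Proof.
by move=> SF; apply: integ_sum => i _; apply: integ_sum => j _; case: (SF i j).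
Qed.

(** Pythagoras in L^2: after expanding the square only the diagonal remains. *)
Lemma Rintegral_sqr_sum (I : finType) (F : I -> T -> R) :
  (forall i, sqint (F i)) ->
  (forall i j, i != j -> \int[P]_t (F i t * F j t) = 0) ->
  \int[P]_t ((\sum_i F i t) ^+ 2) = \sum_i \int[P]_t (F i t ^+ 2).
Proof.
move=> SF F0; rewrite (@eq_RintegralT (fun t => \sum_i \sum_j F i t * F j t)); last first.
  move=> t _; rewrite expr2 mulr_suml; apply: eq_bigr => i _.
  by rewrite mulr_sumr.
rewrite Rintegral_sum => [|i _]; last by apply: integ_sum => j _; exact: integM.
apply: eq_bigr => i _; rewrite Rintegral_sum => [|j _]; last exact: integM.
rewrite (bigD1 i)//= big1 ?addr0 => [|j ji]; first by [].
by rewrite F0// eq_sym.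
Qed.

End SquareIntegrable.

(** * The norm weighted by the equilibrium vector *)

Section WeightedNorm.
Variable R : realType.

(** Cauchy-Schwarz by induction on the list. The new cross term 2 S a b is at most A b^2 + B a^2, by
    S^2 <= A B and the inequality of arithmetic and geometric means. *)
Lemma sqr_sum_mul_le (I : Type) (r : seq I) (a b : I -> R) :
  (\sum_(i <- r) a i * b i) ^+ 2 <=
  (\sum_(i <- r) a i ^+ 2) * (\sum_(i <- r) b i ^+ 2).
Proof.
elim: r => [|i r IH]; first by rewrite !big_nil expr0n mul0r.
rewrite !big_cons; set S := \sum_(_ <- _) _ * _ in IH *.
set A := \sum_(_ <- _) a _ ^+ 2 in IH *; set B := \sum_(_ <- _) _ in IH *.
have A0 : 0 <= A by apply: sumr_ge0 => *; exact: sqr_ge0.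
have B0 : 0 <= B by apply: sumr_ge0 => *; exact: sqr_ge0.
have le2 : 2 * S * a i * b i <= A * b i ^+ 2 + B * a i ^+ 2.
  apply: le_trans (ler_norm _) _; have r0 : 0 <= A * b i ^+ 2 + B * a i ^+ 2.
    by rewrite addr_ge0// mulr_ge0// sqr_ge0.
  rewrite -(@ler_pXn2r _ 2) ?nnegrE//.
  rewrite real_normK ?num_real//.
  have := sqr_ge0 (A * b i ^+ 2 - B * a i ^+ 2).
  have : S ^+ 2 * (a i * b i) ^+ 2 <= A * B * (a i * b i) ^+ 2.
    by rewrite ler_wpM2r// sqr_ge0.
  nra.
rewrite -subr_ge0.
have -> : (a i ^+ 2 + A) * (b i ^+ 2 + B) - (a i * b i + S) ^+ 2 =
  (A * B - S ^+ 2) + (A * b i ^+ 2 + B * a i ^+ 2 - 2 * S * a i * b i) by ring.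
by rewrite addr_ge0// subr_ge0.
Qed.

Lemma sqnormZ m n c (A : 'M[R]_(m, n)) : sqnorm (c *: A) = c ^+ 2 * sqnorm A.
Proof.
rewrite /sqnorm mulr_sumr; apply: eq_bigr => i _.
by rewrite mulr_sumr; apply: eq_bigr => j _; rewrite mxE exprMn.
Qed.

Lemma l2norm_sqr m n (A : 'M[R]_(m, n)) : l2norm A ^+ 2 = sqnorm A.
Proof. by rewrite sqr_sqrtr// sqnorm_ge0. Qed.

Lemma l2normZ m n c (A : 'M[R]_(m, n)) : l2norm (c *: A) = `|c| * l2norm A.
Proof. by rewrite /l2norm sqnormZ sqrtrM ?sqr_ge0// sqrtr_sqr. Qed.

Lemma sqnorm_mulmx_le m n (A : 'M[R]_(m, n)) (x : 'cV[R]_n) :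
  sqnorm (A *m x) <= sqnorm A * sqnorm x.
Proof.
rewrite /sqnorm mulr_suml; apply: ler_sum => i _.
rewrite big_ord1 mxE (le_trans (sqr_sum_mul_le _ _ _))//.
by under [X in _ <= _ * X]eq_bigr do rewrite big_ord1.
Qed.

Lemma sqnorm_eq0 m n (A : 'M[R]_(m, n)) : (sqnorm A == 0) = (A == 0).
Proof.
apply/eqP/eqP => [|->]; last first.
  by rewrite /sqnorm big1// => i _; rewrite big1// => j _; rewrite mxE expr0n.
move=> /psumr_eq0P A0; apply/matrixP => i j; rewrite mxE.
have /psumr_eq0P Ai0 : \sum_j A i j ^+ 2 = 0.
  by apply: A0 => // k _; apply: sumr_ge0 => l _; exact: sqr_ge0.
by apply/eqP; rewrite -sqrf_eq0 Ai0// => l _; exact: sqr_ge0.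
Qed.

Lemma sqnorm0 m n : sqnorm (0 : 'M[R]_(m, n)) = 0.
Proof. by apply/eqP; rewrite sqnorm_eq0. Qed.

Lemma l2norm0 m n : l2norm (0 : 'M[R]_(m, n)) = 0.
Proof. by rewrite /l2norm sqnorm0 sqrtr0. Qed.

(** The real [sup] is meaningful only for a nonempty set that is bounded above; the Frobenius norm
    of [A] is an upper bound by Cauchy-Schwarz. *)
Lemma spectral_norm_has_sup n (A : 'M[R]_n) :
  has_sup [set l2norm (A *m x) | x in [set x : 'cV[R]_n | l2norm x <= 1]].
Proof.
split; first by exists (l2norm (A *m (0 : 'cV[R]_n))), 0 => //=; rewrite l2norm0.
exists (l2norm A) => _ [x /= x1 <-].
rewrite -(@ler_pXn2r _ 2) ?nnegrE ?sqrtr_ge0// !l2norm_sqr.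
rewrite (le_trans (sqnorm_mulmx_le _ _))// ler_piMr ?sqnorm_ge0//.
by rewrite -l2norm_sqr exprn_ile1 ?sqrtr_ge0.
Qed.

Lemma spectral_norm_ge0 n (A : 'M[R]_n) : 0 <= spectral_norm A.
Proof.
apply: le_trans (sqrtr_ge0 (sqnorm (A *m (0 : 'cV[R]_n)))) _.
apply: sup_upper_bound; first exact: spectral_norm_has_sup.
by exists 0 => //=; rewrite l2norm0.
Qed.

Lemma spectral_normP n (A : 'M[R]_n) (x : 'cV[R]_n) :
  sqnorm (A *m x) <= spectral_norm A ^+ 2 * sqnorm x.
Proof.
have [->|x0] := eqVneq x 0.
  by rewrite mulmx0 sqnorm0 mulr0.
have nx : 0 < l2norm x by rewrite sqrtr_gt0 lt_def sqnorm_eq0 x0 sqnorm_ge0.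
have : l2norm (A *m ((l2norm x)^-1 *: x)) <= spectral_norm A.
  apply: sup_upper_bound; first exact: spectral_norm_has_sup.
  exists ((l2norm x)^-1 *: x) => //=.
  by rewrite l2normZ ger0_norm ?invr_ge0 ?sqrtr_ge0// mulVf// gt_eqF.
rewrite -scalemxAr l2normZ ger0_norm ?invr_ge0 ?sqrtr_ge0//.
rewrite ler_pdivrMl// mulrC => le1.
rewrite -!l2norm_sqr -exprMn ler_pXn2r ?nnegrE ?sqrtr_ge0//.
by rewrite mulr_ge0 ?spectral_norm_ge0 ?sqrtr_ge0.
Qed.

Section PiNorm.
Variables (n : nat) (pi : 'cV[R]_n).
Hypothesis pi_gt0 : forall i, 0 < pi i 0.

(** The squared Frobenius norm of diag(sqrt pi)^-1 z, written entrywise so that it can be integrated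
    term by term. *)
Definition pi_sqnorm d (z : 'M[R]_(n, d)) : R := \sum_i \sum_j z i j ^+ 2 / pi i 0.

Let D : 'M[R]_n := diag_mx (map_mx Num.sqrt pi^T).

Let D_unit : D \in unitmx.
Proof.
rewrite unitmxE det_diag unitfE; apply/prodf_neq0 => i _.
by rewrite !mxE gt_eqF// sqrtr_gt0.
Qed.

Let invD d (z : 'M[R]_(n, d)) i j : (invmx D *m z) i j = z i j / Num.sqrt (pi i 0).
Proof.
have /matrixP/(_ i j) : D *m (invmx D *m z) = z by rewrite mulmxA mulmxV// mul1mx.
rewrite mul_diag_mx !mxE => <-; rewrite mulrAC mulfV ?mul1r//.
by rewrite gt_eqF// sqrtr_gt0.
Qed.

Lemma pi_sqnormE d (z : 'M[R]_(n, d)) : pi_sqnorm z = sqnorm (invmx D *m z).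
Proof.
apply: eq_bigr => i _; apply: eq_bigr => j _.
by rewrite invD exprMn exprVn sqr_sqrtr// ltW.
Qed.

Lemma sqnorm_col m d (A : 'M[R]_(m, d)) : sqnorm A = \sum_j sqnorm (col j A).
Proof.
rewrite /sqnorm exchange_big; apply: eq_bigr => j _; apply: eq_bigr => i _.
by rewrite big_ord1 mxE.
Qed.

Lemma pi_norm_ge0 (A : 'M[R]_n) : 0 <= pi_norm pi A.
Proof. exact: spectral_norm_ge0. Qed.

(** The Frobenius norm splits into columns, and on each column conjugation by [D] turns [A] into the
    matrix whose spectral norm is [pi_norm pi A]. *)
Lemma pi_normP d (A : 'M[R]_n) (z : 'M[R]_(n, d)) :
  pi_sqnorm (A *m z) <= pi_norm pi A ^+ 2 * pi_sqnorm z.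
Proof.
rewrite !pi_sqnormE !(sqnorm_col (invmx D *m _)) mulr_sumr; apply: ler_sum => j _.
have -> : col j (invmx D *m (A *m z)) = invmx D *m A *m D *m col j (invmx D *m z).
  by rewrite !colE !mulmxA -(mulmxA (invmx D *m A) D (invmx D)) mulmxV// mulmx1.
exact: spectral_normP.
Qed.

Lemma pi_sqnorm_ge0 d (z : 'M[R]_(n, d)) : 0 <= pi_sqnorm z.
Proof. by rewrite pi_sqnormE sqnorm_ge0. Qed.

Lemma pi_sqnorm_exp d (A : 'M[R]_n) m (z : 'M[R]_(n, d)) :
  pi_sqnorm (A ^+ m *m z) <= pi_norm pi A ^+ (2 * m) * pi_sqnorm z.
Proof.
elim: m => [|m IH]; first by rewrite expr0 mul1mx mul1r.
rewrite exprS -mulmxE -mulmxA (le_trans (pi_normP _ _))//.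
by rewrite mulnS exprD -mulrA ler_wpM2l// exprn_ge0// pi_norm_ge0.
Qed.

Lemma pi_sqnormZ d c (z : 'M[R]_(n, d)) : pi_sqnorm (c *: z) = c ^+ 2 * pi_sqnorm z.
Proof. by rewrite !pi_sqnormE -scalemxAr sqnormZ. Qed.

Lemma pi_sqnorm0 d : pi_sqnorm (0 : 'M[R]_(n, d)) = 0.
Proof. by rewrite -(scale0r 0) pi_sqnormZ expr0n mul0r. Qed.

Lemma pi_sqnorm_eq0 d (z : 'M[R]_(n, d)) : pi_sqnorm z = 0 -> z = 0.
Proof.
rewrite pi_sqnormE => /eqP; rewrite sqnorm_eq0 => /eqP Dz.
by rewrite -(mul1mx z) -(mulmxV D_unit) -mulmxA Dz mulmx0.
Qed.

(** Entry by entry the gap is e (x - y / e)^2 / pi_i. The free weight [e] lets a long sum be built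
    up term by term without a loss that grows with its length. *)
Lemma pi_sqnormD_young d (z z' : 'M[R]_(n, d)) e : 0 < e ->
  pi_sqnorm (z + z') <= (1 + e) * pi_sqnorm z + (1 + e^-1) * pi_sqnorm z'.
Proof.
move=> e0; rewrite /pi_sqnorm !mulr_sumr -big_split; apply: ler_sum => i _ /=.
rewrite !mulr_sumr -big_split; apply: ler_sum => j _ /=.
have key (x y : R) : (x + y) ^+ 2 <= (1 + e) * x ^+ 2 + (1 + e^-1) * y ^+ 2.
  rewrite -subr_ge0 (_ : _ - _ = e * (x - e^-1 * y) ^+ 2).
    by rewrite mulr_ge0 ?sqr_ge0// ltW.
  by field; rewrite gt_eqF.
rewrite mxE.
have -> : (1 + e) * (z i j ^+ 2 / pi i 0) + (1 + e^-1) * (z' i j ^+ 2 / pi i 0) =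
  ((1 + e) * z i j ^+ 2 + (1 + e^-1) * z' i j ^+ 2) / pi i 0.
  by rewrite !mulrA -mulrDl.
by rewrite ler_wpM2r// invr_ge0 ltW.
Qed.

Lemma pi_sqnormD d (z z' : 'M[R]_(n, d)) :
  pi_sqnorm (z + z') <= 2 * pi_sqnorm z + 2 * pi_sqnorm z'.
Proof. by have := pi_sqnormD_young z z' ltr01; rewrite invr1. Qed.

Lemma pi_sqnormN d (z : 'M[R]_(n, d)) : pi_sqnorm (- z) = pi_sqnorm z.
Proof. by rewrite -scaleN1r pi_sqnormZ sqrrN expr1n mul1r. Qed.

(** Each two-term splitting costs a factor 2; [p] and [q] lie one level deeper than the others,
    hence 8 instead of 4. *)
Lemma pi_sqnorm_split d (a b c p q : 'M[R]_(n, d)) :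
  pi_sqnorm (a - b - (c + (p - q))) <=
  4 * pi_sqnorm a + 4 * pi_sqnorm b + 4 * pi_sqnorm c +
  8 * (pi_sqnorm p + pi_sqnorm q).
Proof.
have := pi_sqnormD (a - b) (- (c + (p - q))); have := pi_sqnormD a (- b).
have := pi_sqnormD c (p - q); have := pi_sqnormD p (- q).
by rewrite !pi_sqnormN; lra.
Qed.

(* Triangle inequality and Cauchy-Schwarz, stated so that no t i is divided by. *)
Lemma pi_sqnorm_sum d (I : Type) (r : seq I) (u : I -> 'M[R]_(n, d)) (t c : I -> R) :
  (forall i, 0 <= t i) -> (forall i, 0 <= c i) ->
  (forall i, pi_sqnorm (u i) <= t i ^+ 2 * c i) ->
  pi_sqnorm (\sum_(i <- r) u i) <= (\sum_(i <- r) t i) * \sum_(i <- r) t i * c i.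
Proof.
move=> t0 c0 utc; elim: r => [|i r IH]; first by rewrite !big_nil pi_sqnorm0 mul0r.
rewrite !big_cons; set u' := \sum_(_ <- _) u _ in IH *.
set S := \sum_(_ <- _) t _ in IH *; set A := \sum_(_ <- _) _ * _ in IH *.
have S0 : 0 <= S by apply: sumr_ge0 => j _.
have A0 : 0 <= A by apply: sumr_ge0 => j _; rewrite mulr_ge0.
have [ti0|ti0] := eqVneq (t i) 0.
  have -> : u i = 0.
    apply: pi_sqnorm_eq0; apply/le_anti; rewrite pi_sqnorm_ge0 andbT.
    by rewrite (le_trans (utc i))// ti0 expr0n mul0r.
  by rewrite ti0 add0r mul0r !add0r.
have [S_0|Sn0] := eqVneq S 0.
  have -> : u' = 0.
    apply: pi_sqnorm_eq0; apply/le_anti; rewrite pi_sqnorm_ge0 andbT.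
    by rewrite (le_trans IH)// S_0 mul0r.
  rewrite addr0 S_0 addr0 (le_trans (utc i))// expr2 -mulrA ler_wpM2l//.
  by rewrite lerDl.
have tp : 0 < t i by rewrite lt_def ti0 t0.
have Sp : 0 < S by rewrite lt_def Sn0 S0.
have e0 : 0 < S / t i by rewrite divr_gt0.
rewrite (le_trans (pi_sqnormD_young (u i) u' e0))//.
have -> : (t i + S) * (t i * c i + A) =
  (1 + S / t i) * (t i ^+ 2 * c i) + (1 + (S / t i)^-1) * (S * A).
  by field; rewrite !gt_eqF.
rewrite lerD// ler_wpM2l//; first by rewrite addr_ge0// ltW.
by rewrite addr_ge0// invr_ge0 ltW.
Qed.

End PiNorm.
End WeightedNorm.

(** * Mixing and consensus dynamics *)

Section Mixing.
Variables (R : realType) (n : nat) (W : 'M[R]_n) (pi : 'cV[R]_n).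
Hypotheses (W_ge0 : nonnegative_mx W) (W_col : column_stochastic W).
Hypothesis W_pi : is_equilibrium W pi.

Local Notation ones := (const_mx 1 : 'rV[R]_n).
Local Notation kappa := (kappa_pi pi).
Local Notation beta := (beta_pi W pi).
Local Notation M := (max_entry pi).
Local Notation m := (min_entry pi).
Local Notation npi := (pi_sqnorm pi).

Definition mixing_dev : 'M[R]_n := W - pi *m ones.
Local Notation B := mixing_dev.

Lemma equilibrium_gt0 i : 0 < pi i 0. Proof. by case: W_pi. Qed.

Lemma equilibrium_sum1 : \sum_i pi i 0 = 1.
Proof.
case: W_pi => _ _ /matrixP/(_ 0 0); rewrite !mxE eqxx /= => pi1.
by apply: etrans pi1; apply: eq_bigr => i _; rewrite mxE mul1r.
Qed.

Lemma equilibrium_dim_gt0 : (0 < n)%N.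
Proof.
rewrite lt0n; apply/eqP => n0; move: equilibrium_sum1; rewrite big1 => [/eqP|i _].
  by rewrite eq_sym oner_eq0.
by move: (ltn_ord i); rewrite [X in (_ < X)%N]n0.
Qed.

Lemma equilibrium_dimR_gt0 : 0 < n%:R :> R. Proof. by rewrite ltr0n equilibrium_dim_gt0. Qed.

Lemma le_max_entry i : pi i 0 <= M. Proof. exact: (le_bigmax _ (fun i => pi i 0)). Qed.

Lemma min_entry_le i : m <= pi i 0. Proof. exact: (bigmin_le _ _ (fun i => pi i 0)). Qed.

Lemma max_entry_gt0 : 0 < M.
Proof. exact: lt_le_trans (equilibrium_gt0 (Ordinal equilibrium_dim_gt0)) (le_max_entry _). Qed.

Lemma min_entry_gt0 : 0 < m.
Proof. by apply: lt_bigmin => [|i _]; [exact: max_entry_gt0|exact: equilibrium_gt0]. Qed.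

Lemma kappa_ge1 : 1 <= kappa.
Proof.
rewrite /kappa_pi ler_pdivlMr ?min_entry_gt0// mul1r.
exact: le_trans (min_entry_le (Ordinal equilibrium_dim_gt0)) (le_max_entry _).
Qed.

Lemma kappa_gt0 : 0 < kappa. Proof. exact: lt_le_trans ltr01 kappa_ge1. Qed.

Lemma max_entryE : M = kappa * m.
Proof. by rewrite /kappa_pi divfK// gt_eqF// min_entry_gt0. Qed.

Lemma max_entry_ge : 1 <= n%:R * M.
Proof.
have <- : \sum_(i < n) M = n%:R * M by rewrite sumr_const card_ord mulr_natl.
by rewrite -equilibrium_sum1; apply: ler_sum => i _; exact: le_max_entry.
Qed.

Lemma min_entry_le_invn : n%:R * m <= 1.
Proof.
have <- : \sum_(i < n) m = n%:R * m by rewrite sumr_const card_ord mulr_natl.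
by rewrite -equilibrium_sum1; apply: ler_sum => i _; exact: min_entry_le.
Qed.

(** 1 / pi_i is at most 1 / min = kappa / max, and the largest entry is at least the average 1 /
    n. *)
Lemma inv_pi_le i : (pi i 0)^-1 <= n%:R * kappa.
Proof.
rewrite -div1r ler_pdivrMr ?equilibrium_gt0// (le_trans max_entry_ge)//.
rewrite max_entryE mulrA ler_wpM2l ?min_entry_le//.
by rewrite mulr_ge0 ?ltW ?equilibrium_dimR_gt0 ?kappa_gt0.
Qed.

(** Of max^2 = kappa^2 min^2 one factor min cancels against [pi i 0], and the other is at most the
    average 1 / n. *)
Lemma max_entry_sqr_le i : M ^+ 2 / pi i 0 <= kappa ^+ 2 / n%:R.
Proof.
rewrite ler_pdivrMr ?equilibrium_gt0// mulrAC ler_pdivlMr ?equilibrium_dimR_gt0//.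
rewrite max_entryE exprMn -mulrA ler_wpM2l ?sqr_ge0//.
rewrite expr2 -mulrA (le_trans (ler_piMr _ _)) ?min_entry_le ?(ltW min_entry_gt0)//.
by rewrite mulrC min_entry_le_invn.
Qed.

Lemma pi_sqnorm_le d (z : 'M[R]_(n, d)) : npi z <= n%:R * kappa * sqnorm z.
Proof.
rewrite /pi_sqnorm /sqnorm mulr_sumr; apply: ler_sum => i _.
rewrite mulr_sumr; apply: ler_sum => j _.
by rewrite mulrC ler_wpM2r ?sqr_ge0 ?inv_pi_le.
Qed.

Lemma beta_ge0 : 0 <= beta. Proof. exact: pi_norm_ge0. Qed.

Lemma mixing_dev_exp d k (z : 'M[R]_(n, d)) :
  npi (B ^+ k *m z) <= beta ^+ (2 * k) * npi z.
Proof. exact: (pi_sqnorm_exp equilibrium_gt0). Qed.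

Lemma ones_pi : ones *m pi = 1. Proof. by case: W_pi. Qed.

Lemma mixing_dev_pi : B *m pi = 0.
Proof.
by case: W_pi => _ Wpi _; rewrite mulmxBl -mulmxA ones_pi Wpi mulmx1 subrr.
Qed.

(** The columns of W z and B z differ by multiples of [pi], which B annihilates. *)
Lemma mixing_devW d (z : 'M[R]_(n, d)) : B *m (W *m z) = B *m (B *m z).
Proof.
have -> : W *m z = B *m z + pi *m ones *m z by rewrite mulmxBl subrK.
by rewrite mulmxDr !mulmxA mixing_dev_pi !mul0mx addr0.
Qed.

Lemma mixing_dev_ones d (z : 'M[R]_(n, d)) : ones *m z = 0 -> W *m z = B *m z.
Proof. by move=> z0; rewrite mulmxBl -mulmxA z0 mulmx0 subr0. Qed.

Lemma row_meanE d (z : 'M[R]_(n, d)) : row_mean z = n%:R^-1 *: (ones *m z).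
Proof.
congr (_ *: _); apply/rowP => j; rewrite summxE !mxE.
by apply: eq_bigr => i _; rewrite !mxE mul1r.
Qed.

Lemma row_mean_mixing d (z : 'M[R]_(n, d)) : row_mean (W *m z) = row_mean z.
Proof. by rewrite !row_meanE mulmxA W_col. Qed.

Lemma row_meanB d (z z' : 'M[R]_(n, d)) : row_mean (z - z') = row_mean z - row_mean z'.
Proof. by rewrite !row_meanE mulmxBr scalerBr. Qed.

Lemma row_meanD d (z z' : 'M[R]_(n, d)) : row_mean (z + z') = row_mean z + row_mean z'.
Proof. by rewrite !row_meanE mulmxDr scalerDr. Qed.

Lemma row_meanZ d c (z : 'M[R]_(n, d)) : row_mean (c *: z) = c *: row_mean z.
Proof. by rewrite !row_meanE -scalemxAr !scalerA mulrC. Qed.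

(** * Closed form of the consensus deviation *)

Section Iterates.
Variables (d : nat) (gamma : R) (x0 : 'rV[R]_d).
Variable g : nat -> 'M[R]_(n, d) -> 'M[R]_(n, d).

Local Notation st k := (push_diging W gamma x0 g k).
Local Notation x k := (pd_x (st k)).
Local Notation y k := (pd_y (st k)).
Local Notation v k := (pd_v (st k)).
Local Notation w k := (pd_w (st k)).

Definition pd_g k := g k (w k).
Local Notation h k := (pd_g k).
Local Notation xbar k := (row_mean (x k)).
Local Notation hbar k := (row_mean (h k)).

Lemma pd_xS k : x k.+1 = W *m (x k - gamma *: y k). Proof. by []. Qed.

Lemma pd_vS k : v k.+1 = W *m v k. Proof. by []. Qed.

Lemma pd_yS k : y k.+1 = W *m (y k + h k.+1 - h k). Proof. by []. Qed.

(** True for the all-ones vector, and preserved because W is nonnegative and fixes [pi]. It bounds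
    the division by [v] uniformly in [k]. *)
Lemma pd_v_ge k i : pi i 0 / M <= v k i 0.
Proof.
elim: k i => [|k IH] i /=.
  by rewrite mxE ler_pdivrMr ?max_entry_gt0// mul1r le_max_entry.
case: W_pi => _ Wpi _; rewrite -{1}Wpi !mxE mulr_suml; apply: ler_sum => j _.
by rewrite -mulrA ler_wpM2l// W_ge0.
Qed.

Lemma pd_v_gt0 k i : 0 < v k i 0.
Proof. by apply: lt_le_trans (pd_v_ge k i); rewrite divr_gt0 ?equilibrium_gt0 ?max_entry_gt0. Qed.

Lemma ones_pd_v k : ones *m v k = n%:R%:M.
Proof.
elim: k => [|k IH] /=; last by rewrite mulmxA W_col.
apply/matrixP => i j; rewrite !mxE !ord1 eqxx.
by under eq_bigr do rewrite !mxE mulr1; rewrite sumr_const card_ord.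
Qed.

Lemma ones_row_mean (z : 'M[R]_(n, d)) : ones *m z = n%:R *: row_mean z.
Proof. by rewrite row_meanE scalerA mulfV ?scale1r// gt_eqF// equilibrium_dimR_gt0. Qed.

Lemma pd_wE k i j : w k i j = x k i j / v k i 0.
Proof.
case: k => [|k]; first by rewrite /= !mxE divr1.
have Vu : diag_mx (v k.+1)^T \in unitmx.
  rewrite unitmxE det_diag unitfE; apply/prodf_neq0 => l _.
  by rewrite mxE gt_eqF// pd_v_gt0.
have VwE : diag_mx (v k.+1)^T *m w k.+1 = x k.+1.
  by rewrite /= mulmxA mulmxV// mul1mx.
move: VwE (pd_v_gt0 k.+1 i).
generalize (v k.+1) (w k.+1) (x k.+1) => v' w' x' <- v'0.
by rewrite mul_diag_mx !mxE mulrAC mulfV ?mul1r// gt_eqF.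
Qed.

(** Gradient tracking: mixing by a column-stochastic matrix keeps the mean, and the added
    differences telescope. *)
Lemma row_mean_y k : row_mean (y k) = hbar k.
Proof.
elim: k => [//|k IH].
by rewrite pd_yS row_mean_mixing row_meanB row_meanD IH addrAC subrr add0r.
Qed.

Lemma xbarS k : xbar k.+1 = xbar k - gamma *: hbar k.
Proof. by rewrite /= row_mean_mixing row_meanB row_meanZ row_mean_y. Qed.

Lemma xbar0 : xbar 0 = x0.
Proof.
rewrite /= row_meanE; apply/rowP => j; rewrite !mxE.
under eq_bigr do rewrite !mxE mul1r.
by rewrite sumr_const card_ord -[x0 0 j *+ n]mulr_natl mulrA mulVf ?mul1r// gt_eqF// equilibrium_dimR_gt0.
Qed.

(** Centred at [v k] and not at its limit n pi, because [w k] divides by exactly [v k]: the error of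
    [w k] is this matrix with row i divided by entry i of [v k]. *)
Definition consensus_dev k : 'M[R]_(n, d) := x k - v k *m xbar k.

(** The matrix to which W is applied has zero column sums, so W acts on it as the contraction B. The
    last term accounts for [v k] not yet being a multiple of [pi]. *)
Lemma consensus_devS k : consensus_dev k.+1 =
  B *m consensus_dev k - gamma *: (B *m y k) + gamma *: (B *m v k *m hbar k).
Proof.
rewrite /consensus_dev xbarS pd_xS pd_vS.
move: (ones_pd_v k) (ones_row_mean (x k)) (ones_row_mean (y k)).
rewrite row_mean_y; move: (xbar k) (hbar k) => xb hb.
move: (x k) (y k) (v k) => xk yk vk vk1 xk1 yk1.
set z := xk - vk *m xb - gamma *: (yk - vk *m hb).
have -> : W *m (xk - gamma *: yk) - W *m vk *m (xb - gamma *: hb) = W *m z.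
  rewrite -mulmxA -mulmxBr; congr (W *m _).
  rewrite /z mulmxBr -scalemxAr; move: (vk *m xb) (vk *m hb) => a b.
  by apply/matrixP => i j; rewrite !mxE; ring.
have z0 : ones *m z = 0.
  rewrite /z !(mulmxBr, =^~ scalemxAr) !mulmxA vk1 !mul_scalar_mx.
  by rewrite xk1 yk1 !subrr scaler0 subrr.
rewrite mixing_dev_ones// /z !(mulmxBr, =^~ scalemxAr) !mulmxA.
move: (B *m xk) (B *m vk *m xb) (B *m yk) (B *m vk *m hb) => a b c e.
by apply/matrixP => i j; rewrite !mxE; ring.
Qed.

Lemma mixing_dev_v k : B *m v k = B ^+ k.+1 *m const_mx 1.
Proof.
elim: k => [|k IH]; first by rewrite /= expr1.
by rewrite pd_vS mixing_devW IH mulmxA mulmxE -exprS.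
Qed.

(** Unrolled with B W = B B. The difference that enters at step j is already mixed once when [y] is
    formed, which makes the exponent k + 1 - j. *)
Lemma mixing_dev_y k : B *m y k =
  B ^+ k.+1 *m y 0 + \sum_(j < k) B ^+ (k.+1 - j) *m (h j.+1 - h j).
Proof.
elim: k => [|k IH]; first by rewrite big_ord0 addr0 expr1.
rewrite pd_yS mixing_devW -addrA !mulmxDr IH mulmxDr mulmxA mulmxE -exprS -addrA.
rewrite [in RHS]big_ord_recr /= mulmx_sumr; congr (_ + (_ + _)).
  apply: eq_bigr => j _; rewrite mulmxA mulmxE -exprS.
  by rewrite -subSn// ltnW// ltnS ltnW.
have -> : (k.+2 - k = 2)%N by rewrite -addn2 addKn.
by rewrite -!mulmxDr mulmxA mulmxE -expr2.
Qed.

(** A second convolution with powers of B: in B^(k-1-l) (B y_l) the input j arrives with total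
    exponent k - j, whatever l is, and it occurs once for each l with j < l < k, that is k - 1 - j
    times. In the same way [y 0] is counted k times. *)
Lemma consensus_devE k : consensus_dev k = gamma *:
  (B ^+ k *m const_mx 1 *m (\sum_(l < k) hbar l) - k%:R *: (B ^+ k *m y 0)
   - \sum_(j < k) (k.-1 - j)%:R *: (B ^+ (k - j) *m (h j.+1 - h j))).
Proof.
elim: k => [|k IH].
  rewrite !big_ord0 mulmx0 scale0r !subr0 scaler0 /consensus_dev xbar0 /=.
  apply/matrixP => i j; rewrite !mxE big_ord1 !mxE mul1r subrr //.
set S := \sum_(j < k) _ *: _ in IH.
have SE : \sum_(j < k.+1) (k - j)%:R *: (B ^+ (k.+1 - j) *m (h j.+1 - h j)) =
    B *m S + \sum_(j < k) B ^+ (k.+1 - j) *m (h j.+1 - h j).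
  rewrite big_ord_recr /= subnn scale0r addr0 mulmx_sumr -big_split.
  apply: eq_bigr => j _ /=.
  rewrite -scalemxAr mulmxA mulmxE -exprS -subSn ?(ltnW (ltn_ord j))//.
  rewrite (_ : (k - j)%N = (k.-1 - j).+1); last first.
    have k0 : (0 < k)%N := leq_ltn_trans (leq0n j) (ltn_ord j).
    by rewrite -subSn ?prednK// -ltnS prednK.
  by rewrite -natr1 scalerDl scale1r.
rewrite consensus_devS IH mixing_dev_v mixing_dev_y SE.
rewrite [\sum_(l < k.+1) _]big_ord_recr /= [in RHS]mulmxDr -natr1.
rewrite -scalemxAr !mulmxBr -(scalemxAr k%:R) !mulmxA !mulmxE -!exprS.
move: (\sum_(j < k) B ^+ (k.+1 - j) *m _) (\sum_(l < k) _) => S' H.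
move: (B *m S) (B ^+ k.+1 *m y 0) => BS By.
move: (B ^+ k.+1 *m const_mx 1) => B1.
move: (B1 *m H) (B1 *m hbar k) => b1 b2.
by apply/matrixP => i j; rewrite !mxE; ring.
Qed.

End Iterates.
End Mixing.

(** * Smooth functions *)

Section Smoothness.
Variables (R : realType) (d : nat).
Implicit Types (F : 'rV[R]_d -> R) (x y h : 'rV[R]_d).

Definition dotr x y : R := \sum_j x 0 j * y 0 j.

Lemma sqnorm_row x : sqnorm x = \sum_j x 0 j ^+ 2.
Proof. by rewrite /sqnorm big_ord1. Qed.

Lemma derive_dotr F x h : differentiable F x -> 'D_h F x = dotr (grad F x) h.
Proof.
move=> dF; rewrite deriveE// {1}(row_sum_delta h) linear_sum; apply: eq_bigr => j _.
by rewrite linearZ /= -deriveE// mxE mulrC.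
Qed.

Lemma dotr_young x y c : 0 < c ->
  dotr x y <= (2 * c)^-1 * sqnorm x + c / 2 * sqnorm y.
Proof.
move=> c0; rewrite !sqnorm_row !mulr_sumr -big_split; apply: ler_sum => j _ /=.
rewrite -subr_ge0 (_ : _ - _ = (2 * c)^-1 * (x 0 j - c * y 0 j) ^+ 2).
  by rewrite mulr_ge0 ?sqr_ge0// invr_ge0 mulr_ge0// ltW.
by field; rewrite gt_eqF.
Qed.

Lemma dotrBl x y h : dotr (x - y) h = dotr x h - dotr y h.
Proof. by rewrite /dotr -sumrB; apply: eq_bigr => j _; rewrite !mxE mulrBl. Qed.

Lemma is_derive_line F x h (t : R) : differentiable F (x + t *: h) ->
  is_derive t 1 (fun s => F (x + s *: h)) (dotr (grad F (x + t *: h)) h).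
Proof.
move=> dF; rewrite -derive_dotr//.
have lineE : (fun s => s^-1 *: (((fun s => F (x + s *: h)) \o shift t) (s *: 1) -
      F (x + t *: h))) =
    (fun s : R => s^-1 *: ((F \o shift (x + t *: h)) (s *: h) - F (x + t *: h))).
  apply/funext => s /=; congr (_ *: (F _ - _)).
  by rewrite scalerDl addrCA scaler1.
split; last by rewrite /derive lineE.
by rewrite /derivable lineE; exact: diff_derivable.
Qed.

(** The mean value theorem is applied along the segment to the difference of F and its quadratic
    upper model, whose derivative is nonpositive at interior points. *)
Lemma descent (L : R) F x y : 0 < L -> lipschitz_gradient L F ->
  F y <= F x + dotr (grad F x) (y - x) + L / 2 * sqnorm (y - x).
Proof.
move=> L0 [dF lipF]; set h := y - x; set c := dotr _ _.
pose q : R := L / 2 * sqnorm h.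
pose psi : R -> R := (fun s => F (x + s *: h)) - (c \*: id + q \*: (id ^+ 2)).
pose dpsi (s : R) : R := dotr (grad F (x + s *: h)) h - (c + q * (2 * s)).
have dpsiP (t : R) : is_derive t 1 psi (dpsi t).
  apply: is_deriveB; first exact: is_derive_line.
  apply: is_derive_eq.
  by rewrite /= /GRing.scale /= !mulr1 expr1.
have psi_cont : {within `[0, 1], continuous psi}.
  by apply: derivable_within_continuous => t _; case: (dpsiP t).
have [t] := @MVT _ psi dpsi 0 1 ltr01 (fun t _ => dpsiP t) psi_cont.
rewrite in_itv /= => /andP[t0 t1].
rewrite subr0 mulr1 => psi01.
have dpsi_le0 : dpsi t <= 0.
  rewrite /dpsi opprD addrA -dotrBl.
  (* With Young weight L t the two halves are balanced, each at most (L t / 2) |h|^2. The weight is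
     positive because the mean value point is interior. *)
  have Lt0 : 0 < L * t by rewrite mulr_gt0.
  rewrite subr_le0 (le_trans (dotr_young _ _ Lt0))//.
  have lip : sqnorm (grad F (x + t *: h) - grad F x) <= (L * t) ^+ 2 * sqnorm h.
    rewrite -!l2norm_sqr -exprMn ler_pXn2r ?nnegrE ?mulr_ge0 ?sqrtr_ge0 ?(ltW L0) ?(ltW t0)//.
    by rewrite (le_trans (lipF _ _))// addrAC subrr add0r l2normZ gtr0_norm// mulrA.
  rewrite /q (_ : L / 2 * sqnorm h * (2 * t) =
    (2 * (L * t))^-1 * ((L * t) ^+ 2 * sqnorm h) + L * t / 2 * sqnorm h); last first.
    by field; rewrite gt_eqF// gt_eqF.
  by rewrite lerD2r ler_wpM2l// invr_ge0 mulr_ge0// ltW.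
move: dpsi_le0; rewrite -psi01 /psi /=.
rewrite !fctE /= scale1r scale0r addr0.
have -> : x + h = y by rewrite /h addrC subrK.
rewrite /GRing.scale /= expr1n expr0n /= !mulr0 !mulr1 addr0 subr0.
by rewrite /q; lra.
Qed.

Lemma grad_average n (f : 'I_n -> 'rV[R]_d -> R) x :
  (forall i, differentiable (f i) x) ->
  grad (average f) x = n%:R^-1 *: \sum_i grad (f i) x.
Proof.
move=> df; apply/rowP => j; rewrite !mxE summxE.
have -> : average f = n%:R^-1 \*: \sum_i f i.
  by apply/funext => z; rewrite /average /= fct_sumE.
have dfj i : derivable (f i) x (delta_mx 0 j) by exact: diff_derivable.
rewrite deriveZ; last exact: derivable_sum.
rewrite derive_sum//; congr (_ * _); apply: eq_bigr => i _.
by rewrite mxE.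
Qed.

Lemma lipschitz_gradient_sqnorm (L : R) F x y : 0 < L -> lipschitz_gradient L F ->
  sqnorm (grad F x - grad F y) <= L ^+ 2 * sqnorm (x - y).
Proof.
move=> L0 [_ lipF].
rewrite -!l2norm_sqr -exprMn ler_pXn2r ?nnegrE ?mulr_ge0 ?sqrtr_ge0 ?(ltW L0)//.
Qed.

Lemma sqnorm_sum_le (I : Type) (r : seq I) (u : I -> 'rV[R]_d) :
  sqnorm (\sum_(i <- r) u i) <= (size r)%:R * \sum_(i <- r) sqnorm (u i).
Proof.
rewrite sqnorm_row; under [in leRHS]eq_bigr do rewrite sqnorm_row.
rewrite exchange_big mulr_sumr; apply: ler_sum => j _.
rewrite summxE -[X in X ^+ 2]mul1r mulr_sumr (le_trans (sqr_sum_mul_le _ _ _))//.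
by rewrite big_const_seq count_predT iter_addr_0 expr1n.
Qed.

Lemma average_lipschitz (L : R) n (f : 'I_n -> 'rV[R]_d -> R) : (0 < n)%N -> 0 < L ->
  (forall i, lipschitz_gradient L (f i)) -> lipschitz_gradient L (average f).
Proof.
move=> n0 L0 Lf; have nR : 0 < n%:R :> R by rewrite ltr0n.
split=> [x|x y].
  have -> : average f = n%:R^-1 \*: \sum_i f i.
    by apply/funext => z; rewrite /average /= fct_sumE.
  apply: differentiableZ; apply: differentiable_sum => i.
  by case: (Lf i).
rewrite !grad_average; try by move=> i; case: (Lf i).
rewrite -(@ler_pXn2r _ 2) ?nnegrE ?mulr_ge0 ?sqrtr_ge0 ?(ltW L0)//.
rewrite exprMn !l2norm_sqr -scalerBr sqnormZ -sumrB.
rewrite exprVn ler_pdivrMl ?exprn_gt0//.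
rewrite (le_trans (sqnorm_sum_le _ _))//.
rewrite [size _](_ : _ = n); last by rewrite -sum1_size sum_nat_const card_ord muln1.
rewrite [n%:R ^+ 2]expr2 -mulrA ler_wpM2l ?(ltW nR)//.
have -> : n%:R * (L ^+ 2 * sqnorm (x - y)) = \sum_(i < n) L ^+ 2 * sqnorm (x - y).
  by rewrite sumr_const card_ord mulr_natl.
by apply: ler_sum => i _; exact: lipschitz_gradient_sqnorm.
Qed.

End Smoothness.

(** * The pathwise estimate *)

Section GeometricSums.
Variable R : realType.

(** Multiplied by (1 - t)^2, the partial sum has a closed form equal to t minus the nonnegative
    remainder t^k (k (1 - t) + t). *)
Lemma sum_natM_geom_le (t : R) k : 0 <= t < 1 ->
  \sum_(m < k) m%:R * t ^+ m <= t / (1 - t) ^+ 2.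
Proof.
case/andP => t0 t1; have t'0 : 0 < 1 - t by rewrite subr_gt0.
rewrite ler_pdivlMr ?exprn_gt0//.
have -> : (\sum_(m < k) m%:R * t ^+ m) * (1 - t) ^+ 2 =
    t - k%:R * t ^+ k + (k%:R - 1) * t ^+ k.+1.
  elim: k => [|k IH]; first by rewrite big_ord0 expr1; ring.
  by rewrite big_ord_recr /= mulrDl IH -natr1 !exprS; ring.
have tk : 0 <= t ^+ k by exact: exprn_ge0.
have r0 : 0 <= t ^+ k * (k%:R * (1 - t) + t).
  by rewrite mulr_ge0// addr_ge0// mulr_ge0// ltW.
rewrite exprS; lra.
Qed.

(** Again by a closed form; its leading part t + t^2 is rounded up to 2 t. *)
Lemma sum_natM2_geom_le (t : R) k : 0 <= t < 1 ->
  \sum_(m < k) m%:R ^+ 2 * t ^+ m <= 2 * t / (1 - t) ^+ 3.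
Proof.
case/andP => t0 t1; have t'0 : 0 < 1 - t by rewrite subr_gt0.
rewrite ler_pdivlMr ?exprn_gt0//.
have -> : (\sum_(m < k) m%:R ^+ 2 * t ^+ m) * (1 - t) ^+ 3 =
    t + t ^+ 2 - t ^+ k * ((k%:R - (k%:R - 1) * t) ^+ 2 + t).
  elim: k => [|k IH]; first by rewrite big_ord0 expr0; ring.
  by rewrite big_ord_recr /= mulrDl IH -natr1 !exprS; ring.
have tk : 0 <= t ^+ k by exact: exprn_ge0.
have r0 : 0 <= t ^+ k * ((k%:R - (k%:R - 1) * t) ^+ 2 + t).
  by rewrite mulr_ge0// addr_ge0 ?sqr_ge0.
nra.
Qed.

Lemma sum_rev_ord (a : nat -> R) k : \sum_(j < k) a (k.-1 - j)%N = \sum_(j < k) a j.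
Proof.
rewrite (reindex_inj rev_ord_inj) /=; apply: eq_bigr => j _; congr (a _).
have k_gt0 : (0 < k)%N := leq_ltn_trans (leq0n j) (ltn_ord j).
have -> : (k - j.+1 = k.-1 - j)%N by rewrite -subn1 -subnDA add1n.
by rewrite subKn// -ltnS prednK.
Qed.

(** After the sums are exchanged, [z j] is weighted by the partial sum of the kernel over m < K -
    j. *)
Lemma sum_conv_le (a z : nat -> R) A K : (forall N, \sum_(m < N) a m <= A) ->
  (forall j, 0 <= z j) ->
  \sum_(k < K.+1) \sum_(j < k) a (k.-1 - j)%N * z j <= A * \sum_(j < K) z j.
Proof.
move=> aA z0.
suff -> : \sum_(k < K.+1) \sum_(j < k) a (k.-1 - j)%N * z j =
    \sum_(j < K) (\sum_(m < K - j) a m) * z j.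
  by rewrite mulr_sumr; apply: ler_sum => j _; rewrite ler_wpM2r.
elim: K => [|K IH]; first by rewrite big_ord_recl !big_ord0 addr0.
rewrite big_ord_recr /= IH.
rewrite [RHS](eq_bigr (fun j : 'I_K.+1 =>
    (\sum_(m < K - j) a m) * z j + a (K - j)%N * z j)); last first.
  move=> j _; have jK : (j <= K)%N by rewrite -ltnS.
  by rewrite -mulrDl (subSn jK) big_ord_recr.
rewrite big_split /=; congr (_ + _).
by rewrite big_ord_recr /= subnn big_ord0 mul0r addr0.
Qed.

End GeometricSums.

Section ScalarAbsorption.
Variables (R : realType) (N L gamma kappa beta Rr Y s NN : R).
Hypotheses (N_ge1 : 1 <= N) (L_gt0 : 0 < L) (gamma_gt0 : 0 < gamma).
Hypotheses (kappa_ge1 : 1 <= kappa) (beta0 : 0 <= beta) (beta_lt1 : beta < 1).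
Hypotheses (Rr0 : 0 <= Rr) (Y0 : 0 <= Y) (s0 : 0 <= s) (NN0 : 0 <= NN).
Hypotheses (gamma_L : gamma * L <= 1 / 2).
Hypothesis gamma_beta : 40 * (gamma * L) * kappa ^+ 7 * beta <= (1 - beta) ^+ 2.

Let b := beta / (1 - beta).
Let c := gamma * L.

(* The products below are controlled by p := c * kappa^7 * beta / (1 - beta)^2 <= 1/40. *)
Lemma absorb_consensus_error (E := L ^+ 2 / N * s) :
  E <= L ^+ 2 / N * (kappa ^+ 2 / N * (gamma ^+ 2 *
    (4 * (N ^+ 2 * kappa * b ^+ 2 * Rr) +
     4 * (N * kappa * (2 * beta ^+ 2 / (1 - beta) ^+ 3) * Y) +
     4 * (b ^+ 4 * (N * kappa * L ^+ 2 * 3 * (2 * s + N * gamma ^+ 2 * Rr))) +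
     8 * NN))) ->
  E <= 11 / 100 * (gamma * L) * Rr + 1 / 100 * Y +
    9 * (gamma * L) ^+ 2 * kappa ^+ 2 / N ^+ 2 * NN.
Proof.
move=> Eraw.
have N0 : 0 < N by exact: lt_le_trans ltr01 N_ge1.
have k0 : 0 < kappa by exact: lt_le_trans ltr01 kappa_ge1.
have b' : 0 < 1 - beta by rewrite subr_gt0.
have c0 : 0 < c by rewrite mulr_gt0.
pose i := (1 - beta)^-1; pose p := c * kappa ^+ 7 * beta * i ^+ 2.
have i1 : 1 <= i by rewrite invf_ge1// lerBlDr lerDl.
have i0 : 0 <= i by exact: le_trans ler01 i1.
have ke m : 0 <= kappa ^+ m by rewrite exprn_ge0// ltW.
have p0 : 0 <= p.
  exact: mulr_ge0 (mulr_ge0 (mulr_ge0 (ltW c0) (ke 7)) beta0) (exprn_ge0 2 i0).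
have p40 : p <= 1 / 40.
  have : p * (1 - beta) ^+ 2 <= 1 / 40 * (1 - beta) ^+ 2.
    rewrite /p /i exprVn divfK ?expf_neq0 ?gt_eqF// /c.
    by move: gamma_beta; lra.
  by rewrite ler_pM2r// exprn_gt0.
have beta_le1 : beta <= 1 by exact: ltW.
have kX m m' : (m <= m')%N -> kappa ^+ m <= kappa ^+ m' by exact: ler_weXn2l.
have bX m m' : (m' <= m)%N -> beta ^+ m <= beta ^+ m' by exact: ler_wiXn2l.
have iX m m' : (m <= m')%N -> i ^+ m <= i ^+ m' by exact: ler_weXn2l.
(* Since kappa >= 1, beta <= 1 and 1 / (1 - beta) >= 1, monomials compare by their exponents. The
   targets are those of p, namely 7, 1, 2, and of p^2, namely 14, 2, 4. *)
have mono a1 a2 a3 b1 b2 b3 : (a1 <= b1)%N -> (b2 <= a2)%N -> (a3 <= b3)%N ->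
    kappa ^+ a1 * beta ^+ a2 * i ^+ a3 <= kappa ^+ b1 * beta ^+ b2 * i ^+ b3.
  move=> h1 h2 h3; apply: (ler_pM _ _ _ (iX _ _ h3)); rewrite ?exprn_ge0//.
    exact: mulr_ge0 (ke _) (exprn_ge0 _ beta0).
  by apply: (ler_pM _ _ (kX _ _ h1) (bX _ _ h2)); rewrite ?ke ?exprn_ge0.
have p2 : p ^+ 2 <= 1 / 1600 by nra.
have hi : c * kappa ^+ 3 * b ^+ 2 <= 1 / 40.
  apply: le_trans p40; have := mono 3 2 2 7 1 2 isT isT isT.
  rewrite -(ler_pM2l c0) => m1.
  rewrite (_ : c * _ * _ = c * (kappa ^+ 3 * beta ^+ 2 * i ^+ 2)); last first.
    by rewrite /b -/i; ring.
  by apply: (le_trans m1); rewrite /p expr1 !mulrA.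
have hii : c ^+ 2 * kappa ^+ 3 * beta ^+ 2 * i ^+ 3 <= 1 / 1600.
  apply: le_trans p2; have := mono 3 2 3 14 2 4 isT isT isT.
  rewrite -(ler_pM2l (exprn_gt0 2 c0)) => m1.
  rewrite (_ : c ^+ 2 * _ * _ * _ = c ^+ 2 * (kappa ^+ 3 * beta ^+ 2 * i ^+ 3)).
    by apply: (le_trans m1); rewrite /p le_eqVlt; apply/orP; left; apply/eqP; ring.
  by ring.
have hiii : c ^+ 2 * kappa ^+ 3 * b ^+ 4 <= 1 / 1600.
  apply: le_trans p2; have := mono 3 4 4 14 2 4 isT isT isT.
  rewrite -(ler_pM2l (exprn_gt0 2 c0)) => m1.
  rewrite (_ : c ^+ 2 * _ * _ = c ^+ 2 * (kappa ^+ 3 * beta ^+ 4 * i ^+ 4)).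
    by apply: (le_trans m1); rewrite /p le_eqVlt; apply/orP; left; apply/eqP; ring.
  by rewrite /b -/i; ring.
(* [E] recurs on the right with coefficient at most 24/1600 and is moved to the left. Division by
   the remaining 197/200 rounds the other coefficients up to 11/100, 1/100 and 9. *)
move: Eraw; rewrite (_ : L ^+ 2 / N * _ =
    4 * (c * kappa ^+ 3 * b ^+ 2) * (c * Rr) +
    8 * (c ^+ 2 * kappa ^+ 3 * beta ^+ 2 * i ^+ 3) * (Y / N) +
    12 * (c ^+ 2 * kappa ^+ 3 * b ^+ 4) * (2 * E + c * (c * Rr)) +
    8 * (c ^+ 2 * kappa ^+ 2 / N ^+ 2 * NN)); last first.
  rewrite /E /c /b /i; field.
  by rewrite !gt_eqF.
have cR0 : 0 <= c * Rr by rewrite mulr_ge0// ltW.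
have Yn : 0 <= Y / N <= Y.
  by rewrite divr_ge0 ?(ltW N0)//= ler_pdivrMr// ler_peMr.
have E0 : 0 <= E by rewrite /E mulr_ge0// divr_ge0 ?sqr_ge0 ?(ltW N0).
have c12 : c <= 1 / 2 by [].
have g1 : c * kappa ^+ 3 * b ^+ 2 * (c * Rr) <= 1 / 40 * (c * Rr) by rewrite ler_wpM2r.
have g2 : c ^+ 2 * kappa ^+ 3 * beta ^+ 2 * i ^+ 3 * (Y / N) <= 1 / 1600 * Y.
  by case/andP: Yn => *; rewrite ler_pM//;
    exact: mulr_ge0 (mulr_ge0 (mulr_ge0 (sqr_ge0 c) (ke 3)) (sqr_ge0 beta)) (exprn_ge0 3 i0).
have g3a : 0 <= 2 * E + c * (c * Rr) by rewrite addr_ge0// mulr_ge0// ltW.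
have g3 : c ^+ 2 * kappa ^+ 3 * b ^+ 4 * (2 * E + c * (c * Rr)) <=
    1 / 1600 * (2 * E + c * (c * Rr)) by rewrite ler_wpM2r.
have g4 : c * (c * Rr) <= 1 / 2 * (c * Rr) by rewrite ler_wpM2r.
have NNc : 0 <= c ^+ 2 * kappa ^+ 2 / N ^+ 2 * NN.
  by rewrite mulr_ge0// divr_ge0 ?sqr_ge0//; exact: mulr_ge0 (sqr_ge0 _) (sqr_ge0 _).
rewrite (_ : 11 / 100 * (gamma * L) * Rr = 11 / 100 * (c * Rr)); last by rewrite /c; ring.
rewrite (_ : 9 * (gamma * L) ^+ 2 * kappa ^+ 2 / N ^+ 2 * NN =
  9 * (c ^+ 2 * kappa ^+ 2 / N ^+ 2 * NN)); last by rewrite /c; ring.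
lra.
Qed.
End ScalarAbsorption.

Section PointwiseEstimate.
Local Opaque push_diging.
Variables (R : realType) (n d : nat) (W : 'M[R]_n) (pi : 'cV[R]_n).
Variables (gamma L Delta : R) (x0 : 'rV[R]_d).
Variables (f : 'I_n -> 'rV[R]_d -> R) (g : nat -> 'M[R]_(n, d) -> 'M[R]_(n, d)).
Hypotheses (W_ge0 : nonnegative_mx W) (W_col : column_stochastic W).
Hypotheses (W_pi : is_equilibrium W pi) (beta_lt1 : beta_pi W pi < 1).
Hypotheses (L_gt0 : 0 < L) (f_smooth : forall i, lipschitz_gradient L (f i)).
Hypothesis f_gap : forall x, average f x0 - average f x <= Delta.
Hypotheses (gamma_gt0 : 0 < gamma) (gamma_L : gamma * L <= 1 / 2).
Hypothesis gamma_beta :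
  40 * (gamma * L) * kappa_pi pi ^+ 7 * beta_pi W pi <= (1 - beta_pi W pi) ^+ 2.

Local Notation kappa := (kappa_pi pi).
Local Notation beta := (beta_pi W pi).
Local Notation npi := (pi_sqnorm pi).
Local Notation B := (mixing_dev W pi).
Local Notation st k := (push_diging W gamma x0 g k).
Local Notation x k := (pd_x (st k)).
Local Notation y k := (pd_y (st k)).
Local Notation v k := (pd_v (st k)).
Local Notation w k := (pd_w (st k)).
Local Notation h := (pd_g W gamma x0 g).
Local Notation xbar k := (row_mean (x k)).
Local Notation hbar k := (row_mean (h k)).
Local Notation X := (consensus_dev W gamma x0 g).

Definition grad_rows (z : 'M[R]_(n, d)) : 'M[R]_(n, d) :=
  \matrix_(i, j) grad (f i) (row i z) 0 j.

Definition pd_noise k : 'M[R]_(n, d) := h k - grad_rows (w k).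

(* The consensus error propagates an input u of the tracking recursion through
   the kernel m |-> m * B ^+ m.+1. *)
Definition propagate k (u : nat -> 'M[R]_(n, d)) : 'M[R]_(n, d) :=
  \sum_(j < k) (k.-1 - j)%:R *: (B ^+ (k - j) *m u j).

Local Notation e k := (sqnorm (w k - all_rows n (xbar k))).
Local Notation r k := (sqnorm (hbar k)).
Local Notation gbar k := (row_mean (grad_rows (w k))).
Local Notation sbar k := (row_mean (pd_noise k)).

Let pi_gt0' := equilibrium_gt0 W_pi.
Let n_gt0' := equilibrium_dim_gt0 W_pi.
Let nR : 0 < n%:R :> R := equilibrium_dimR_gt0 W_pi.
Let beta0 : 0 <= beta := beta_ge0 W pi.
Let k1 : 1 <= kappa := kappa_ge1 W_pi.
Let k0 : 0 < kappa := kappa_gt0 W_pi.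
Let b' : 0 < 1 - beta. Proof. by rewrite subr_gt0. Qed.

(** By 1 / v_i <= max / pi_i. Of the resulting 1 / pi_i^2 one factor is the weight of [npi]; the
    other is bounded together with max^2. *)
Lemma consensus_error_le k : e k <= kappa ^+ 2 / n%:R * npi (X k).
Proof.
rewrite /sqnorm /pi_sqnorm mulr_sumr; apply: ler_sum => i _.
rewrite mulr_sumr; apply: ler_sum => j _.
have v0 : 0 < v k i 0 := pd_v_gt0 W_ge0 W_pi gamma x0 g k i.
have -> : (w k - all_rows n (xbar k)) i j = X k i j / v k i 0.
  rewrite /consensus_dev !mxE big_ord1 (pd_wE W_ge0 W_pi) mulrBl; congr (_ - _).
  by rewrite !mxE mulrAC mulfV ?mul1r// gt_eqF.
rewrite exprMn [leRHS]mulrCA ler_wpM2l ?sqr_ge0//.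
have M0 := max_entry_gt0 W_pi; have pi0 := pi_gt0' i.
have vM : (v k i 0)^-1 <= max_entry pi / pi i 0.
  rewrite -[leRHS]invrK invf_div lef_pV2 ?posrE ?divr_gt0//.
  exact: pd_v_ge.
apply: le_trans (_ : (max_entry pi / pi i 0) ^+ 2 <= _).
  by rewrite ler_pXn2r ?nnegrE ?invr_ge0 ?divr_ge0 ?(ltW M0) ?(ltW pi0) ?(ltW v0).
rewrite exprMn [X in _ * X]expr2 mulrA ler_wpM2r ?invr_ge0 ?(ltW pi0)//.
exact: (max_entry_sqr_le W_pi).
Qed.

Lemma sqnorm_all_rows (z : 'rV[R]_d) : sqnorm (all_rows n z) = n%:R * sqnorm z.
Proof.
rewrite /sqnorm big_ord1 (eq_bigr (fun=> \sum_j z 0 j ^+ 2)).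
  by rewrite sumr_const card_ord mulr_natl.
by move=> i _; apply: eq_bigr => j _; rewrite mxE.
Qed.

(** Passing through the means leaves two consensus errors and the step -gamma hbar of the mean; 3 is
    the price of squaring a sum of three terms. *)
Lemma pd_w_diff_le j :
  sqnorm (w j.+1 - w j) <= 3 * (e j.+1 + e j + n%:R * gamma ^+ 2 * r j).
Proof.
have -> : n%:R * gamma ^+ 2 * r j = sqnorm (all_rows n (gamma *: hbar j)).
  by rewrite sqnorm_all_rows sqnormZ mulrA.
have -> : w j.+1 - w j = (w j.+1 - all_rows n (xbar j.+1)) -
    (w j - all_rows n (xbar j)) - all_rows n (gamma *: hbar j).
  have -> : all_rows n (xbar j.+1) = all_rows n (xbar j) - all_rows n (gamma *: hbar j).
    by rewrite xbarS//; apply/matrixP => i l; rewrite !mxE.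
  move: (w j.+1) (w j) (all_rows n (xbar j)) (all_rows n _) => a b c q.
  by apply/matrixP => i l; rewrite !mxE; ring.
move: (w j.+1 - all_rows n (xbar j.+1)) (w j - all_rows n (xbar j)).
move: (all_rows n (gamma *: hbar j)) => c a b.
rewrite /sqnorm -!big_split mulr_sumr; apply: ler_sum => i _ /=.
rewrite -!big_split mulr_sumr; apply: ler_sum => l _ /=; rewrite !mxE.
move: (a i l) (b i l) (c i l) => p q s.
have := sqr_ge0 (p + q); have := sqr_ge0 (p + s); have := sqr_ge0 (q - s); nra.
Qed.

Lemma grad_rows_diff_le z z' :
  npi (grad_rows z - grad_rows z') <= n%:R * kappa * L ^+ 2 * sqnorm (z - z').
Proof.
apply: le_trans (pi_sqnorm_le W_pi _) _.
rewrite -[leRHS]mulrA ler_wpM2l//; first exact: mulr_ge0 (ler0n _ _) (ltW k0).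
rewrite /sqnorm mulr_sumr; apply: ler_sum => i _.
have := lipschitz_gradient_sqnorm (row i z) (row i z') L_gt0 (f_smooth i).
rewrite /sqnorm !big_ord1 => le1.
rewrite [leLHS](eq_bigr (fun j => (grad (f i) (row i z) - grad (f i) (row i z')) 0 j ^+ 2)).
  apply: le_trans le1 _; rewrite ler_wpM2l ?sqr_ge0//.
  by apply: ler_sum => j _; rewrite !mxE.
by move=> j _; rewrite !mxE.
Qed.

Let t_ge0 k j : 0 <= (k.-1 - j)%:R * beta ^+ (k - j).
Proof. by rewrite mulr_ge0// exprn_ge0. Qed.

Lemma subn_ord_predS k (j : 'I_k) : (k - j)%N = (k.-1 - j).+1.
Proof.
have k_gt0 : (0 < k)%N := leq_ltn_trans (leq0n j) (ltn_ord j).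
by rewrite -subSn ?prednK// -ltnS prednK.
Qed.

Lemma propagate_term_le k j (z : 'M[R]_(n, d)) :
  npi ((k.-1 - j)%:R *: (B ^+ (k - j) *m z)) <=
  ((k.-1 - j)%:R * beta ^+ (k - j)) ^+ 2 * npi z.
Proof.
rewrite (pi_sqnormZ pi_gt0') [in leRHS]exprMn -[leRHS]mulrA ler_wpM2l ?sqr_ge0//.
by rewrite -exprM mulnC mixing_dev_exp.
Qed.

Let sum_weights_le N : \sum_(m < N) m%:R * beta ^+ m.+1 <= (beta / (1 - beta)) ^+ 2.
Proof.
have -> : \sum_(m < N) m%:R * beta ^+ m.+1 = beta * \sum_(m < N) m%:R * beta ^+ m.
  by rewrite mulr_sumr; apply: eq_bigr => m _; rewrite exprS mulrCA.
rewrite expr2 mulf_div -expr2 -mulrA ler_wpM2l//.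
by rewrite sum_natM_geom_le// beta0.
Qed.

(** The weights m beta^(m+1) have total mass at most (beta / (1 - beta))^2, and this mass enters
    twice: through Cauchy-Schwarz within one [propagate], and through the convolution when summing
    over k. *)
Lemma propagate_sum_le K u :
  \sum_(k < K.+1) npi (propagate k u) <=
  (beta / (1 - beta)) ^+ 4 * \sum_(j < K) npi (u j).
Proof.
pose a m : R := m%:R * beta ^+ m.+1.
have step k : npi (propagate k u) <=
    (beta / (1 - beta)) ^+ 2 * \sum_(j < k) a (k.-1 - j)%N * npi (u j).
  apply: le_trans (pi_sqnorm_sum pi_gt0' (I := 'I_k) _ (fun j => t_ge0 k j)
    (fun j => pi_sqnorm_ge0 pi_gt0' (u j)) (fun j => propagate_term_le k j (u j))) _.
  under eq_bigr do rewrite subn_ord_predS.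
  under [X in _ * X]eq_bigr do rewrite subn_ord_predS.
  rewrite ler_wpM2r//; last by rewrite (sum_rev_ord a) sum_weights_le.
  by apply: sumr_ge0 => j _; rewrite !mulr_ge0 ?exprn_ge0 ?(pi_sqnorm_ge0 pi_gt0').
rewrite (le_trans (ler_sum _ (fun (k : 'I_K.+1) _ => step k)))//.
rewrite -mulr_sumr (exprD (beta / _) 2 2) -[leRHS]mulrA ler_wpM2l ?sqr_ge0//.
apply: (@sum_conv_le _ a (fun j => npi (u j))) => [N|j]; first exact: sum_weights_le.
exact: (pi_sqnorm_ge0 pi_gt0').
Qed.


Lemma propagateD k u u' :
  propagate k (fun j => u j + u' j) = propagate k u + propagate k u'.
Proof.
by rewrite /propagate -big_split; apply: eq_bigr => j _; rewrite mulmxDr scalerDr.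
Qed.

Lemma propagateN k u : propagate k (fun j => - u j) = - propagate k u.
Proof.
by rewrite /propagate -sumrN; apply: eq_bigr => j _; rewrite mulmxN scalerN.
Qed.

Let dG j := grad_rows (w j.+1) - grad_rows (w j).

Let Vk k : R := npi (B ^+ k *m const_mx 1 *m (\sum_(l < k) hbar l)).
Let Yk k : R := k%:R ^+ 2 * npi (B ^+ k *m y 0).
Let Nk k : R := npi (propagate k (fun j => pd_noise j.+1)) + npi (propagate k pd_noise).

(** The inputs are the drift of the mean, the initial tracking variable, the gradient differences
    and the two noise sequences. *)
Let consensus_split k :
  npi (X k) <= gamma ^+ 2 * (4 * Vk k + 4 * Yk k + 4 * npi (propagate k dG) + 8 * Nk k).
Proof.
have hE : (fun j => h j.+1 - h j) =
    (fun j => dG j + (pd_noise j.+1 + - pd_noise j)).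
  apply/funext => j; rewrite /dG /pd_noise.
  move: (h j.+1) (h j) (grad_rows (w j.+1)) (grad_rows (w j)) => a b c q.
  by apply/matrixP => i l; rewrite !mxE; ring.
rewrite (consensus_devE W_col W_pi) -/(propagate k (fun j => h j.+1 - h j)) hE.
rewrite (propagateD k dG (fun j => pd_noise j.+1 + - pd_noise j)).
rewrite (propagateD k (fun j => pd_noise j.+1) (fun j => - pd_noise j)) propagateN.
rewrite (pi_sqnormZ pi_gt0') ler_wpM2l ?sqr_ge0//.
apply: le_trans (pi_sqnorm_split pi_gt0' _ _ _ _ _) _.
by rewrite [npi (k%:R *: _)](pi_sqnormZ pi_gt0').
Qed.

Let b2 : 0 <= beta ^+ 2 < 1.
Proof. by rewrite sqr_ge0 exprn_ilt1. Qed.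

Let one_sub_b2 : 1 - beta <= 1 - beta ^+ 2.
Proof. by rewrite lerD2l lerN2 expr2 ler_piMl// ltW. Qed.

(** The crude bound k S for the squared sum of k means suffices, since the decay beta^(2k) outweighs
    the factor k. *)
Let sum_Vk_le K : \sum_(k < K.+1) Vk k <=
  n%:R ^+ 2 * kappa * (beta / (1 - beta)) ^+ 2 * \sum_(l < K.+1) r l.
Proof.
set S := \sum_(l < K.+1) r l.
have S0 : 0 <= S by apply: sumr_ge0 => l _; exact: sqnorm_ge0.
have c0 : 0 <= n%:R ^+ 2 * kappa by rewrite mulr_ge0 ?(ltW k0)// exprn_ge0.
have step (k : 'I_K.+1) : Vk k <= n%:R ^+ 2 * kappa * S * (k%:R * (beta ^+ 2) ^+ k).
  rewrite /Vk -mulmxA; apply: le_trans (mixing_dev_exp W_pi _ _) _.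
  rewrite exprM [X in X <= _]mulrC [X in _ <= X]mulrA ler_wpM2r ?exprn_ge0 ?sqr_ge0//.
  apply: le_trans (pi_sqnorm_le W_pi _) _.
  have -> : const_mx 1 *m \sum_(l < k) hbar l = all_rows n (\sum_(l < k) hbar l).
    by apply/matrixP => i j; rewrite !mxE big_ord1 !mxE mul1r.
  rewrite sqnorm_all_rows.
  have le1 : sqnorm (\sum_(l < k) hbar l) <= k%:R * S.
    apply: le_trans (sqnorm_sum_le _ _) _.
    rewrite -sum1_size sum_nat_const card_ord muln1 ler_wpM2l//.
    rewrite /S (big_ord_widen K.+1 (fun l => r l)) 1?ltnW//.
    by rewrite [leRHS](bigID (fun l : 'I_K.+1 => (l < k)%N)) /= lerDl sumr_ge0// => l _;
      exact: sqnorm_ge0.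
  rewrite (_ : n%:R * kappa * (n%:R * _) = n%:R ^+ 2 * kappa *
    sqnorm (\sum_(l < k) hbar l)); last by ring.
  by rewrite -[leRHS]mulrA ler_wpM2l// [leRHS]mulrC.
apply: le_trans (ler_sum _ (fun k _ => step k)) _.
rewrite -mulr_sumr [leLHS]mulrAC ler_wpM2r// ler_wpM2l//.
apply: le_trans (sum_natM_geom_le _ b2) _.
rewrite exprMn exprVn ler_wpM2l ?sqr_ge0// lef_pV2 ?posrE ?exprn_gt0//; last first.
  exact: lt_le_trans one_sub_b2.
by rewrite ler_pXn2r ?nnegrE ?(ltW b')// (le_trans _ one_sub_b2)// ltW.
Qed.

Let sum_Yk_le K : \sum_(k < K.+1) Yk k <=
  n%:R * kappa * (2 * beta ^+ 2 / (1 - beta) ^+ 3) * sqnorm (y 0).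
Proof.
have c0 : 0 <= n%:R * kappa by rewrite mulr_ge0 ?(ltW k0).
have step (k : 'I_K.+1) : Yk k <=
    n%:R * kappa * sqnorm (y 0) * (k%:R ^+ 2 * (beta ^+ 2) ^+ k).
  rewrite /Yk [leRHS]mulrCA ler_wpM2l ?sqr_ge0//.
  apply: le_trans (mixing_dev_exp W_pi _ _) _.
  rewrite exprM [leLHS]mulrC ler_wpM2r ?exprn_ge0 ?sqr_ge0//.
  exact: (pi_sqnorm_le W_pi).
apply: le_trans (ler_sum _ (fun k _ => step k)) _.
rewrite -mulr_sumr [leLHS]mulrAC ler_wpM2r ?sqnorm_ge0// ler_wpM2l//.
apply: le_trans (sum_natM2_geom_le _ b2) _.
rewrite ler_wpM2l ?mulr_ge0 ?sqr_ge0// lef_pV2 ?posrE ?exprn_gt0//; last first.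
  exact: lt_le_trans one_sub_b2.
by rewrite ler_pXn2r ?nnegrE ?(ltW b')// (le_trans _ one_sub_b2)// ltW.
Qed.

Let sum_dG_le K : \sum_(k < K.+1) npi (propagate k dG) <=
  (beta / (1 - beta)) ^+ 4 * (n%:R * kappa * L ^+ 2 * 3 *
    (2 * \sum_(k < K.+1) e k + n%:R * gamma ^+ 2 * \sum_(k < K.+1) r k)).
Proof.
apply: le_trans (propagate_sum_le K dG) _.
have b40 : 0 <= (beta / (1 - beta)) ^+ 4.
  by rewrite exprn_ge0 ?divr_ge0 ?(ltW b').
rewrite ler_wpM2l//.
have c0 : 0 <= n%:R * kappa * L ^+ 2.
  by rewrite mulr_ge0 ?sqr_ge0// mulr_ge0 ?(ltW k0).
have step (j : 'I_K) : npi (dG j) <= n%:R * kappa * L ^+ 2 * (3 *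
    (e j.+1 + e j + n%:R * gamma ^+ 2 * r j)).
  apply: le_trans (grad_rows_diff_le _ _) _.
  by rewrite ler_wpM2l// pd_w_diff_le.
apply: le_trans (ler_sum _ (fun j _ => step j)) _.
rewrite -mulr_sumr -[leRHS]mulrA ler_wpM2l// -mulr_sumr ler_wpM2l// !big_split /=.
rewrite -mulr_sumr.
have e0 k : 0 <= e k by exact: sqnorm_ge0.
have r0 k : 0 <= r k by exact: sqnorm_ge0.
have le1 : \sum_(j < K) e j.+1 <= \sum_(k < K.+1) e k.
  by rewrite [leRHS]big_ord_recl /= lerDr.
have le2 : \sum_(j < K) e j <= \sum_(k < K.+1) e k.
  by rewrite [leRHS]big_ord_recr /= lerDl.
have le3 : n%:R * gamma ^+ 2 * \sum_(j < K) r j <=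
    n%:R * gamma ^+ 2 * \sum_(k < K.+1) r k.
  rewrite ler_wpM2l//; first exact: mulr_ge0 (ler0n _ _) (sqr_ge0 _).
  by rewrite [leRHS]big_ord_recr /= lerDl.
lra.
Qed.


Let E : nat -> R := fun K => L ^+ 2 / n%:R * \sum_(k < K.+1) e k.

(** Resolves the implicit inequality [Eraw], in which the summed consensus errors also occur on the
    right through the gradient differences. *)
Let consensus_sum_le K : E K <= 11 / 100 * (gamma * L) * (\sum_(k < K.+1) r k) +
  1 / 100 * sqnorm (y 0) +
  9 * (gamma * L) ^+ 2 * kappa ^+ 2 / n%:R ^+ 2 * \sum_(k < K.+1) Nk k.
Proof.
set Rr := \sum_(k < K.+1) r k; set NN := \sum_(k < K.+1) Nk k.
set Y := sqnorm (y 0).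
have Rr0 : 0 <= Rr by apply: sumr_ge0 => *; exact: sqnorm_ge0.
have Y0 : 0 <= Y by exact: sqnorm_ge0.
have NN0 : 0 <= NN.
  by apply: sumr_ge0 => *; rewrite addr_ge0// (pi_sqnorm_ge0 pi_gt0').
have Es0 : 0 <= \sum_(k < K.+1) e k by apply: sumr_ge0 => *; exact: sqnorm_ge0.
pose b := beta / (1 - beta).
have N1 : 1 <= n%:R :> R by rewrite ler1n n_gt0'.
apply: (absorb_consensus_error N1 L_gt0 gamma_gt0 k1 beta0 beta_lt1 Rr0 Y0 Es0 NN0
  gamma_L gamma_beta).
have Eraw : E K <= L ^+ 2 / n%:R * (kappa ^+ 2 / n%:R * (gamma ^+ 2 *
    (4 * (n%:R ^+ 2 * kappa * b ^+ 2 * Rr) +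
     4 * (n%:R * kappa * (2 * beta ^+ 2 / (1 - beta) ^+ 3) * Y) +
     4 * (b ^+ 4 * (n%:R * kappa * L ^+ 2 * 3 *
       (2 * (\sum_(k < K.+1) e k) + n%:R * gamma ^+ 2 * Rr))) + 8 * NN))).
  rewrite /E ler_wpM2l ?divr_ge0 ?sqr_ge0//.
  apply: le_trans (ler_sum _ (fun (k : 'I_K.+1) _ => consensus_error_le k)) _.
  rewrite -mulr_sumr ler_wpM2l ?divr_ge0 ?sqr_ge0//.
  apply: le_trans (ler_sum _ (fun (k : 'I_K.+1) _ => consensus_split k)) _.
  rewrite -mulr_sumr ler_wpM2l ?sqr_ge0// !big_split /= -!mulr_sumr.
  have := sum_Vk_le K; have := sum_Yk_le K; have := sum_dG_le K.
  rewrite -/Rr -/Y -/b -/NN.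
  move: (\sum_(k < K.+1) Vk k) (\sum_(k < K.+1) Yk k) (\sum_(k < K.+1) npi _).
  move=> q1 q2 q3 h1 h2 h3.
  by rewrite lerD2r !lerD// ler_wpM2l.
exact: Eraw.
Qed.

Local Notation F := (average f).

Let F_smooth : lipschitz_gradient L F.
Proof. exact: average_lipschitz. Qed.

Let hbarE k : hbar k = gbar k + sbar k.
Proof. by rewrite -row_meanD /pd_noise addrC subrK. Qed.

Let grad_mean_le k : sqnorm (grad F (xbar k) - gbar k) <= L ^+ 2 / n%:R * e k.
Proof.
rewrite grad_average; last by move=> i; case: (f_smooth i).
have -> : gbar k = n%:R^-1 *: \sum_i grad (f i) (row i (w k)).
  congr (_ *: _); apply: eq_bigr => i _; apply/rowP => j; rewrite !mxE.
  by [].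
rewrite -scalerBr -sumrB sqnormZ exprVn.
rewrite [L ^+ 2 / _]mulrC -mulrA expr2 invfM -mulrA ler_wpM2l ?invr_ge0//.
rewrite ler_pdivrMl//; apply: le_trans (sqnorm_sum_le _ _) _.
rewrite -sum1_size sum_nat_const card_ord muln1 ler_wpM2l//.
rewrite /sqnorm -/(sqnorm _) mulr_sumr; apply: ler_sum => i _.
apply: le_trans (lipschitz_gradient_sqnorm _ _ L_gt0 (f_smooth i)) _.
rewrite ler_wpM2l ?sqr_ge0// sqnorm_row; apply: ler_sum => j _.
by rewrite !mxE -[leLHS]sqrrN opprB.
Qed.

Let polarization (a c : 'rV[R]_d) :
  2 * dotr a c = sqnorm a + sqnorm c - sqnorm (a - c).
Proof.
rewrite !sqnorm_row /dotr mulr_sumr -big_split -sumrB; apply: eq_bigr => j _ /=.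
by rewrite !mxE; ring.
Qed.

Let dotrDr (a c c' : 'rV[R]_d) : dotr a (c + c') = dotr a c + dotr a c'.
Proof. by rewrite /dotr -big_split; apply: eq_bigr => j _; rewrite mxE mulrDr. Qed.

Let dotrZr (a c : 'rV[R]_d) t : dotr a (t *: c) = t * dotr a c.
Proof. by rewrite /dotr mulr_sumr; apply: eq_bigr => j _; rewrite mxE mulrCA. Qed.

(** The weights are unequal on purpose. The sum of [r] ends up with coefficient 1.11 gamma L, and
    gamma L <= 1/2, so 3/2 leaves 0.8325 < 1 in front of the mean gradients; equal weights 2 would
    leave 1.11. *)
Let hbar_le k : r k <= 3 / 2 * sqnorm (gbar k) + 3 * sqnorm (sbar k).
Proof.
rewrite hbarE !sqnorm_row !mulr_sumr -big_split; apply: ler_sum => j _ /=.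
rewrite [(gbar k + sbar k) 0 j]mxE; move: (gbar k 0 j) (sbar k 0 j) => a c.
have := sqr_ge0 (a - 2 * c); nra.
Qed.

Let descent_sum K :
  F (xbar K.+1) <= F x0 - gamma * (\sum_(k < K.+1) dotr (grad F (xbar k)) (hbar k)) +
    L / 2 * gamma ^+ 2 * \sum_(k < K.+1) r k.
Proof.
have step k : F (xbar k.+1) <= F (xbar k) - gamma * dotr (grad F (xbar k)) (hbar k) +
    L / 2 * gamma ^+ 2 * r k.
  apply: le_trans (descent (xbar k) (xbar k.+1) L_gt0 F_smooth) _.
  have -> : xbar k.+1 - xbar k = - gamma *: hbar k.
    by rewrite (xbarS W_col) addrAC subrr add0r scaleNr.
  by rewrite dotrZr mulNr sqnormZ sqrrN mulrA.
elim: K => [|K IH].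
  have F0 : F (xbar 0) = F x0 by rewrite (xbar0 W_pi).
  rewrite (big_ord1 _ (fun k => dotr (grad F (xbar k)) (hbar k))).
  by rewrite (big_ord1 _ (fun k => r k)) -F0; exact: step.
apply: le_trans (step _) _.
rewrite (big_ord_recr _ (fun k : 'I_K.+2 => dotr (grad F (xbar k)) (hbar k))) /=.
rewrite (big_ord_recr _ (fun k : 'I_K.+2 => r k)) /=; lra.
Qed.

(** Polarization puts the squared mean gradients [gbar] on the left with coefficient 1, and they
    absorb the share of [gbar] inside [r]. The inner product with [sbar] is kept unestimated because
    it has mean zero. *)
Lemma pointwise_estimate K :
  \sum_(k < K.+1) sqnorm (grad F (xbar k)) <=
  2 * Delta / gamma - 2 * \sum_(k < K.+1) dotr (grad F (xbar k)) (sbar k)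
  + 4 * (gamma * L) * (\sum_(k < K.+1) sqnorm (sbar k)) + sqnorm (y 0)
  + 9 * (gamma * L) ^+ 2 * kappa ^+ 2 / n%:R ^+ 2 *
    \sum_(k < K.+1) (npi (propagate k (fun j => pd_noise j.+1)) +
                     npi (propagate k pd_noise)).
Proof.
have := consensus_sum_le K; have := descent_sum K; have := f_gap (xbar K.+1).
rewrite -/(\sum_(k < K.+1) Nk k).
have -> : \sum_(k < K.+1) dotr (grad F (xbar k)) (hbar k) =
    \sum_(k < K.+1) dotr (grad F (xbar k)) (gbar k) +
    \sum_(k < K.+1) dotr (grad F (xbar k)) (sbar k).
  by rewrite -big_split; apply: eq_bigr => k _; rewrite hbarE dotrDr.
have : \sum_(k < K.+1) sqnorm (grad F (xbar k)) + \sum_(k < K.+1) sqnorm (gbar k)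
    <= 2 * (\sum_(k < K.+1) dotr (grad F (xbar k)) (gbar k)) + E K.
  rewrite /E !mulr_sumr -!big_split; apply: ler_sum => k _ /=.
  by rewrite polarization; have := grad_mean_le k; lra.
have : \sum_(k < K.+1) r k <= 3 / 2 * (\sum_(k < K.+1) sqnorm (gbar k)) +
    3 * \sum_(k < K.+1) sqnorm (sbar k).
  by rewrite !mulr_sumr -!big_split; apply: ler_sum => k _; exact: hbar_le.
have Q0 : 0 <= \sum_(k < K.+1) sqnorm (gbar k) by apply: sumr_ge0 => *; exact: sqnorm_ge0.
have S0 : 0 <= \sum_(k < K.+1) sqnorm (sbar k) by apply: sumr_ge0 => *; exact: sqnorm_ge0.
have R0 : 0 <= \sum_(k < K.+1) r k by apply: sumr_ge0 => *; exact: sqnorm_ge0.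
have Y0 : 0 <= sqnorm (y 0) by exact: sqnorm_ge0.
move: Q0 S0 R0 Y0; move: (E K) (F (xbar K.+1)).
move: (\sum_(k < K.+1) sqnorm (gbar k)) (\sum_(k < K.+1) sqnorm (sbar k)).
move: (\sum_(k < K.+1) r k) (sqnorm (y 0)) (\sum_(k < K.+1) sqnorm (grad F _)).
move: (\sum_(k < K.+1) dotr _ (gbar k)) (\sum_(k < K.+1) dotr _ (sbar k)).
move: (9 * _ ^+ 2 * _ / _ * _) => NN D1 D2 Rr Y Pp Q S EK FK Q0 S0 R0 Y0 hr hp hF hd hE.
set c := gamma * L in hE *.
have c0 : 0 < c by rewrite mulr_gt0.
have cL : c <= 1 / 2 by [].
have hD : D1 + D2 <= Delta / gamma + c / 2 * Rr.
  rewrite -(ler_pM2l gamma_gt0) [leRHS]mulrDr (mulrC gamma (Delta / gamma)) divfK ?gt_eqF//.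
  by rewrite /c; lra.
have cQ : c * Q <= 1 / 2 * Q by rewrite ler_wpM2r.
have cR : c * Rr <= c * (3 / 2 * Q + 3 * S) by rewrite ler_wpM2l// ltW.
have cS : 0 <= c * S by rewrite mulr_ge0// ltW.
rewrite -mulrA; move: (Delta / gamma) hD => q hD.
lra.
Qed.

End PointwiseEstimate.

(** * Noise along the iterates *)

Section Oracle.
Context {dT dX : measure_display} {T : measurableType dT} {R : realType}.
Context {P : probability T R} {n d : nat} {X : 'I_n -> measurableType dX}.
Unset Implicit Arguments.
Variable G : forall i : 'I_n, 'rV[R]_d -> X i -> 'rV[R]_d.
Variable xi : forall i : 'I_n, nat -> {RV P >-> X i}.
Variables (f : 'I_n -> 'rV[R]_d -> R) (sigma : R).

Local Notation Past S := (@past _ _ T R P ('I_n * nat)%type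
  (fun ik => X ik.1) (fun ik => xi ik.1 ik.2) S).
Local Notation pmeas S h := (measurable_fun (setT : set (Past S)) h).

Hypothesis G_measurable : forall i, measurable_oracle (G i).
Hypothesis G_unbiased : forall i k x j,
  ('E_P[fun w => (G i x (xi i k w) 0 j)%R] = (grad (f i) x 0 j)%:E)%E.
Hypothesis G_variance : forall i k x,
  ('E_P[fun w => sqnorm (G i x (xi i k w) - grad (f i) x)%R]
     <= (sigma ^+ 2)%:E)%E.
Hypothesis indep :
  mutually_independent (I := ('I_n * nat)%type) (E := fun ik => X ik.1)
    (fun ik => xi ik.1 ik.2).
Set Implicit Arguments.

Lemma oracle_sample_measurable i k x j :
  measurable_fun setT (fun t => G i x (xi i k t) 0 j).
Proof.
have mx : measurable_fun setT (fun t => ([tuple x 0 l | l < d], xi i k t)).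
  apply/measurable_fun_pair; first exact: measurable_cst.
  exact: measurable_funP.
have := measurableT_comp (G_measurable i j) mx.
apply: eq_measurable_fun => t _ /=; congr (G i _ _ 0 j).
by apply/rowP => l; rewrite mxE tnth_mktuple.
Qed.

Definition noise i k (w : T -> 'rV[R]_d) (t : T) : 'rV[R]_d :=
  G i (w t) (xi i k t) - grad (f i) (w t).

Lemma noise_cst_sqint i k x j : sqint P (fun t => noise i k (fun=> x) t 0 j).
Proof.
have mN l : measurable_fun setT (fun t => noise i k (fun=> x) t 0 l).
  apply: (eq_measurable_fun (fun t => G i x (xi i k t) 0 l - grad (f i) x 0 l)).
    by move=> t _; rewrite /noise !mxE.
  by apply: measurable_funB => //; exact: oracle_sample_measurable.
apply: (@sqint_le _ _ _ _ _ (fun t => sqnorm (noise i k (fun=> x) t))) => //.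
  move=> t; rewrite /sqnorm big_ord1 (bigD1 j)//= lerDl.
  by apply: sumr_ge0 => l _; exact: sqr_ge0.
apply/integrableP; split.
  apply/measurable_EFinP; rewrite /sqnorm; under eq_fun do rewrite big_ord1.
  by apply: measurable_sum => l; exact: measurable_funX.
under eq_integral do rewrite gee0_abs ?lee_fin ?sqnorm_ge0//.
  by have := G_variance i k x; rewrite expectationE => /le_lt_trans; apply; exact: ltry.
Qed.

Lemma oracle_cst_integ i k x j : integ P (fun t => G i x (xi i k t) 0 j).
Proof.
apply: eq_integ (integD (sqint_integ (noise_cst_sqint i k x j))
  (integ_cst P (grad (f i) x 0 j))).
by move=> t; rewrite /noise !mxE subrK.
Qed.

Lemma oracle_tuple_measurable i j :
  measurable_fun setT (fun p : d.-tuple R * X i => G i (\row_l tnth p.1 l) p.2 0 j).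
Proof. exact: G_measurable. Qed.

(* The gradient is the partial integral of the oracle in its sample, hence measurable. *)
Lemma grad_measurable i j :
  measurable_fun setT (fun p : d.-tuple R => grad (f i) (\row_l tnth p l) 0 j).
Proof.
apply/measurable_EFinP.
pose h (p : d.-tuple R * X i) := (G i (\row_l tnth p.1 l) p.2 0 j)%:E.
have mh : measurable_fun setT h.
  apply/measurable_EFinP; exact: oracle_tuple_measurable.
apply: (eq_measurable_fun (fun p : d.-tuple R =>
  \int[distribution P (xi i 0%N)]_x (h^\+ (p, x)) -
  \int[distribution P (xi i 0%N)]_x (h^\- (p, x)))%E).
  move=> p _ /=; rewrite -(G_unbiased i 0%N) expectationE [RHS]integralE.
  rewrite !ge0_integral_distribution//.
  - by congr (_ - _)%E; apply: eq_integral => t _; rewrite /= ?funeposE ?funenegE.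
  - exact: measurableT_comp (measurable_funeneg mh) (measurable_pair1 p).
  - exact: measurableT_comp (measurable_funepos mh) (measurable_pair1 p).
apply: emeasurable_funB.
  by apply: measurable_fun_fubini_tonelli_F => //; exact: measurable_funepos.
by apply: measurable_fun_fubini_tonelli_F => //; exact: measurable_funeneg.
Qed.

Let tup (w : T -> 'rV[R]_d) (t : T) : d.-tuple R := [tuple w t 0 j | j < d].

Let tupK w t : \row_l tnth (tup w t) l = w t.
Proof. by apply/rowP => l; rewrite mxE tnth_mktuple. Qed.

Let pmeas_tup S (w : T -> 'rV[R]_d) : (forall j, pmeas S (fun t => w t 0 j)) -> pmeas S (tup w).
Proof.
move=> mw; apply/measurable_fun_tnthP => l.
by apply: eq_measurable_fun (mw l) => t _ /=; rewrite tnth_mktuple.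
Qed.

Lemma pmeas_grad S i j (w : T -> 'rV[R]_d) : (forall j, pmeas S (fun t => w t 0 j)) ->
  pmeas S (fun t => grad (f i) (w t) 0 j).
Proof.
move=> mw; have := measurableT_comp (grad_measurable i j) (pmeas_tup mw).
by apply: eq_measurable_fun => t _ /=; rewrite tupK.
Qed.

Lemma pmeas_noise (S : set ('I_n * nat)) i k j (w : T -> 'rV[R]_d) : S (i, k) -> (forall j, pmeas S (fun t => w t 0 j)) ->
  pmeas S (fun t => noise i k w t 0 j).
Proof.
move=> Sik mw.
apply: (eq_measurable_fun (fun t : Past S =>
    G i (w t) (xi i k t) 0 j - grad (f i) (w t) 0 j)).
  by move=> t _; rewrite /noise !mxE.
apply: measurable_funB; last exact: pmeas_grad.
have mX : pmeas S (xi i k) by exact: (@past_measurable_RV _ _ _ _ _ _ _ _ S (i, k)).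
have mp : pmeas S (fun t => (tup w t, xi i k t)).
  by apply/measurable_fun_pair => //; exact: pmeas_tup.
have := measurableT_comp (@oracle_tuple_measurable i j) mp.
by apply: eq_measurable_fun => t _ /=; rewrite tupK.
Qed.

Let noise_fun i (p : d.-tuple R * X i) : 'rV[R]_d :=
  G i (\row_l tnth p.1 l) p.2 - grad (f i) (\row_l tnth p.1 l).

Let noise_funE i k w t : noise_fun (tup w t, xi i k t) = noise i k w t.
Proof. by rewrite /noise_fun /= tupK. Qed.

Let noise_fun_measurable i j : measurable_fun setT (fun p => @noise_fun i p 0 j).
Proof.
apply: (eq_measurable_fun (fun p : d.-tuple R * X i =>
    G i (\row_l tnth p.1 l) p.2 0 j - grad (f i) (\row_l tnth p.1 l) 0 j)).
  by move=> p _; rewrite /noise_fun !mxE.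
apply: measurable_funB; first exact: oracle_tuple_measurable.
exact: measurableT_comp (grad_measurable i j) measurable_fst.
Qed.

(** * Noise at a point determined by other samples *)

Section OneSample.
Variables (S : set ('I_n * nat)) (i : 'I_n) (k : nat) (w : T -> 'rV[R]_d).
Hypotheses (Sik : ~ S (i, k)) (mw : forall j, pmeas S (fun t => w t 0 j)).

(** Freezing carries the variance bound from deterministic points to a point that depends on other
    samples only. *)
Lemma noise_variance :
  (\int[P]_t (sqnorm (noise i k w t))%:E <= (sigma ^+ 2)%:E)%E.
Proof.
pose h (p : d.-tuple R * X i) := (sqnorm (noise_fun p))%:E.
have mh : measurable_fun setT h.
  apply/measurable_EFinP; rewrite /h /sqnorm; under eq_fun do rewrite big_ord1.
  by apply: measurable_sum => l; apply: measurable_funX; exact: noise_fun_measurable.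
have h0 p : (0 <= h p)%E.
  by rewrite lee_fin sqnorm_ge0.
have := @indep_integral_le _ _ _ _ _ _ _ _ indep _ _ S (i, k) (tup w) Sik
  (pmeas_tup mw) h (sigma ^+ 2) mh h0.
rewrite (eq_integral (fun t => (sqnorm (noise i k w t))%:E)); last first.
  by move=> t _; rewrite /h noise_funE.
apply => p; have := G_variance i k (\row_l tnth p l).
by rewrite expectationE.
Qed.

Lemma noise_sqint j : sqint P (fun t => noise i k w t 0 j).
Proof.
have mN l : measurable_fun setT (fun t => noise i k w t 0 l).
  (* The past of all samples is used here, since the noise involves the sample (i, k), which lies
     outside [S]. *)
  apply: (@past_measurable_fun _ _ _ _ _ _ _ _ setT).
  apply: (@pmeas_noise setT) => // l'.
  by apply: past_sub (mw l') => //.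
apply: (@sqint_le _ _ _ _ _ (fun t => sqnorm (noise i k w t))) => //.
  move=> t; rewrite /sqnorm big_ord1 (bigD1 j)//= lerDl.
  by apply: sumr_ge0 => l _; exact: sqr_ge0.
apply/integrableP; split.
  apply/measurable_EFinP; rewrite /sqnorm; under eq_fun do rewrite big_ord1.
  by apply: measurable_sum => l; exact: measurable_funX.
under eq_integral do rewrite gee0_abs ?lee_fin ?sqnorm_ge0//.
by apply: le_lt_trans noise_variance _; exact: ltry.
Qed.

(** The pair of [h] and the point [w] is frozen; what is left is a constant times the noise at a
    fixed point, which is unbiased. *)
Lemma noise_orthogonal (h : T -> R) j : pmeas S h -> sqint P h ->
  \int[P]_t (h t * noise i k w t 0 j) = 0.
Proof.
move=> mh Sh; have := @indep_integral0 _ _ _ _ _ _ _ _ indep _ _ S (i, k)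
  (fun t => (h t, tup w t)) Sik _
  (fun z => (z.1.1 * noise_fun (z.1.2, z.2) 0 j)%:E).
rewrite (eq_integral (fun t => (h t * noise i k w t 0 j)%:E)); last first.
  by move=> t _ /=; rewrite noise_funE.
rewrite /Rintegral => -> //=.
- by apply/measurable_fun_pair => //; exact: pmeas_tup.
- apply/measurable_EFinP; apply: measurable_funM.
    exact: measurableT_comp measurable_fst measurable_fst.
  have mz : measurable_fun setT (fun z : (R * d.-tuple R) * X i => (z.1.2, z.2)).
    apply/measurable_fun_pair => //.
    exact: measurableT_comp measurable_snd measurable_fst.
  exact: measurableT_comp (@noise_fun_measurable i j) mz.
- apply: eq_integ (integM Sh (noise_sqint j)) => t /=.
  by rewrite noise_funE.
- move=> [y p].
  apply: (integZ y (sqint_integ (noise_cst_sqint i k (\row_l tnth p l) j))).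
- move=> [y p]; rewrite /=.
  have Ng := sqint_integ (noise_cst_sqint i k (\row_l tnth p l) j).
  have -> : (\int[P]_u (y * noise_fun (p, xi i k u) 0 j)%:E =
      (\int[P]_u (y * noise i k (fun=> \row_l tnth p l) u 0 j))%:E)%E.
    by rewrite (Rintegral_fineK (integZ y Ng)).
  rewrite RintegralZl//.
  rewrite (_ : \int[P]_u _ = \int[P]_u (G i (\row_l tnth p l) (xi i k u) 0 j -
      grad (f i) (\row_l tnth p l) 0 j)); last first.
    by apply: eq_Rintegral => u _; rewrite /noise !mxE.
  rewrite RintegralB//; [|exact: oracle_cst_integ|exact: integ_cst].
  rewrite Rintegral_cst_probability /Rintegral.
  by have := G_unbiased i k (\row_l tnth p l) j; rewrite expectationE => ->; rewrite subrr mulr0.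
Qed.

End OneSample.


(** The two properties travel together because orthogonality uses both: the first for freezing, the
    second for the integrability of products. *)
Definition adapted S m p (F : T -> 'M[R]_(m, p)) : Prop :=
  forall a b, pmeas S (fun t => F t a b) /\ sqint P (fun t => F t a b).

Lemma adapted_sub S S' m p (F : T -> 'M[R]_(m, p)) : S `<=` S' ->
  adapted S F -> adapted S' F.
Proof. by move=> SS' aF a b; have [mF sF] := aF a b; split => //; exact: past_sub mF. Qed.

Lemma eq_adapted S m p (F F' : T -> 'M[R]_(m, p)) : F =1 F' ->
  adapted S F -> adapted S F'.
Proof. by move=> /funext ->. Qed.

Lemma adapted_cst S m p (A : 'M[R]_(m, p)) : adapted S (fun=> A).
Proof. by move=> a b; split; [exact: measurable_cst|exact: sqint_cst]. Qed.

Lemma adaptedD S m p (F F' : T -> 'M[R]_(m, p)) : adapted S F -> adapted S F' ->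
  adapted S (fun t => F t + F' t).
Proof.
move=> aF aF' a b; have [mF sF] := aF a b; have [mF' sF'] := aF' a b; split.
  apply: (eq_measurable_fun (fun t : Past S => F t a b + F' t a b)).
    by move=> t _; rewrite mxE.
  exact: measurable_funD.
by apply: eq_sqint (sqintD sF sF') => t; rewrite mxE.
Qed.

Lemma adapted_mulmx S q m p (A : 'M[R]_(q, m)) (F : T -> 'M[R]_(m, p)) :
  adapted S F -> adapted S (fun t => A *m F t).
Proof.
move=> aF a b; split.
  apply: (eq_measurable_fun (fun t : Past S => \sum_c A a c * F t c b)).
    by move=> t _; rewrite mxE.
  by apply: measurable_sum => c; apply: measurable_funM => //; case: (aF c b).
apply: (@eq_sqint _ _ _ _ (fun t => \sum_c A a c * F t c b)).
  by move=> t; rewrite mxE.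
by apply: sqint_sum => c _; apply: sqintZ; case: (aF c b).
Qed.

Lemma adaptedZ S m p c (F : T -> 'M[R]_(m, p)) : adapted S F ->
  adapted S (fun t => c *: F t).
Proof.
by move=> aF; apply: eq_adapted (adapted_mulmx c%:M aF) => t; rewrite mul_scalar_mx.
Qed.

Lemma adaptedB S m p (F F' : T -> 'M[R]_(m, p)) : adapted S F -> adapted S F' ->
  adapted S (fun t => F t - F' t).
Proof.
move=> aF aF'; apply: eq_adapted (adaptedD aF (adaptedZ (-1) aF')) => t.
by rewrite scaleN1r.
Qed.

Lemma adapted_row S m p (F : T -> 'M[R]_(m, p)) i : adapted S F ->
  adapted S (fun t => row i (F t)).
Proof.
move=> aF a b; have [mF sF] := aF i b; split.
  apply: (eq_measurable_fun (fun t : Past S => F t i b)) mF.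
  by move=> t _; rewrite mxE.
by apply: eq_sqint sF => t; rewrite mxE.
Qed.

Section Lipschitz.
Variable L : R.
Hypotheses (L_gt0 : 0 < L) (f_smooth : forall i, lipschitz_gradient L (f i)).

(** A Lipschitz gradient grows at most linearly, so it keeps square integrability. *)
Lemma adapted_grad S i (w : T -> 'rV[R]_d) : adapted S w ->
  adapted S (fun t => grad (f i) (w t)).
Proof.
move=> aw a j; rewrite ord1.
have mg := pmeas_grad i j (fun l => (aw 0 l).1); split => //.
apply: (@sqint_le _ _ _ _ _ (fun t => 2 * (L ^+ 2 * sqnorm (w t)) +
    2 * grad (f i) 0 0 j ^+ 2)).
- exact: past_measurable_fun mg.
- move=> t; have := lipschitz_gradient_sqnorm (w t) 0 L_gt0 (f_smooth i).
  rewrite subr0 sqnorm_row; move: (L ^+ 2 * _) => q hq.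
  have le1 : (grad (f i) (w t) 0 j - grad (f i) 0 0 j) ^+ 2 <= q.
    apply: le_trans hq; rewrite (bigD1 j)//= !mxE lerDl.
    by apply: sumr_ge0 => l _; exact: sqr_ge0.
  have := sqr_ge0 (grad (f i) (w t) 0 j - 2 * grad (f i) 0 0 j); nra.
- apply: integD; last exact: integ_cst.
  by do 2 apply: integZ; apply: integ_sqnorm => b l; case: (aw b l).
Qed.

Lemma adapted_grad_rows S (z : T -> 'M[R]_(n, d)) : adapted S z ->
  adapted S (fun t => grad_rows f (z t)).
Proof.
move=> az i j; have [mg sg] := adapted_grad i (adapted_row i az) 0 j; split.
  apply: (eq_measurable_fun (fun t : Past S => grad (f i) (row i (z t)) 0 j)) mg.
  by move=> t _; rewrite [RHS]mxE.
by apply: eq_sqint sg => t; rewrite [RHS]mxE.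
Qed.

Definition noise_rows k (z : T -> 'M[R]_(n, d)) (t : T) : 'M[R]_(n, d) :=
  stoch_grad G (fun i => xi i k t) (z t) - grad_rows f (z t).

Lemma noise_rowsE k z t i j :
  noise_rows k z t i j = noise i k (fun t => row i (z t)) t 0 j.
Proof. by rewrite /noise_rows /noise !mxE. Qed.

Lemma adapted_noise_rows S S' k z : S `<=` S' -> (forall i, S' (i, k)) ->
  (forall i, ~ S (i, k)) -> adapted S z -> adapted S' (noise_rows k z).
Proof.
move=> SS' S'k Sk az i j; split.
  apply: (eq_measurable_fun (fun t : Past S' =>
      noise i k (fun t => row i (z t)) t 0 j)).
    by move=> t _; rewrite noise_rowsE.
  apply: pmeas_noise => // l; case: (adapted_row i az 0 l) => + _.
  exact: past_sub.
apply: (@eq_sqint _ _ _ _ (fun t => noise i k (fun t => row i (z t)) t 0 j)).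
  by move=> t; rewrite noise_rowsE.
by apply: (noise_sqint (Sk i)) => l; case: (adapted_row i az 0 l).
Qed.

(** The stochastic gradient at a random point is square integrable as the sum of gradient and noise,
    each by its own argument. *)
Lemma adapted_stoch_grad S S' k z : S `<=` S' -> (forall i, S' (i, k)) ->
  (forall i, ~ S (i, k)) -> adapted S z ->
  adapted S' (fun t => stoch_grad G (fun i => xi i k t) (z t)).
Proof.
move=> SS' S'k Sk az.
have aN := adapted_noise_rows SS' S'k Sk az.
have aG := adapted_sub SS' (adapted_grad_rows az).
by apply: eq_adapted (adaptedD aN aG) => t; rewrite subrK.
Qed.

(** * Adaptedness and orthogonality along the algorithm *)

Section Iterates.
Variables (W : 'M[R]_n) (gamma : R) (x0 : 'rV[R]_d).

Local Notation g := (fun (t : T) (k : nat) => stoch_grad G (fun i => xi i k t)).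
Local Notation st t k := (push_diging W gamma x0 (g t) k).

Definition before k : set ('I_n * nat) := [set il | (il.2 < k)%N].

Lemma before_sub k l : (k <= l)%N -> before k `<=` before l.
Proof. by move=> kl il /= ilk; exact: leq_trans ilk kl. Qed.

(** The weights are deterministic, so dividing by them is a fixed linear map and preserves
    adaptedness. *)
Lemma pd_v_cst k t : pd_v (st t k) = iter k (mulmx W) (const_mx 1).
Proof. by elim: k => //= k ->. Qed.

(** The shift of the index matters: [w k] uses only samples of iterations before k, hence is
    independent of the samples evaluated at it, whereas [y k] already contains those of iteration
    k. *)
Lemma adapted_iterates k :
  [/\ adapted (before k) (fun t => pd_x (st t k)),
      adapted (before k) (fun t => pd_w (st t k)) &
      adapted (before k.+1) (fun t => pd_y (st t k))].
Proof.
have past_k l i : ~ before l (i, l) by rewrite /before /= ltnn.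
have now_k l i : before l.+1 (i, l) by rewrite /before /=.
elim: k => [|k [ax aw ay]].
  split; [exact: adapted_cst|exact: adapted_cst|].
  by apply: (adapted_stoch_grad (before_sub (leqnSn 0))) => //; exact: adapted_cst.
have ax' : adapted (before k.+1) (fun t => pd_x (st t k.+1)).
  apply: adapted_mulmx; apply: adaptedB; last exact: adaptedZ.
  exact: adapted_sub (before_sub (leqnSn k)) ax.
have aw' : adapted (before k.+1) (fun t => pd_w (st t k.+1)).
  have := adapted_mulmx (invmx (diag_mx (iter k.+1 (mulmx W) (const_mx 1))^T)) ax'.
  by apply: eq_adapted => t; rewrite -(pd_v_cst k.+1 t).
split => //; apply: adapted_mulmx; apply: adaptedB.
  apply: adaptedD; first exact: adapted_sub (before_sub (leqnSn _)) ay.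
  exact: (adapted_stoch_grad (before_sub (leqnSn k.+1))).
apply: (adapted_sub (before_sub (leqnSn k.+1))).
exact: (adapted_stoch_grad (before_sub (leqnSn k))).
Qed.

Local Notation ws := (fun k t => pd_w (st t k)).

Definition iter_noise k := noise_rows k (ws k).

Lemma adapted_iter_noise k : adapted (before k.+1) (iter_noise k).
Proof.
have [_ aw _] := adapted_iterates k.
apply: (adapted_noise_rows (before_sub (leqnSn k))) aw => i; rewrite /before /= ?ltnn//.
Qed.

Lemma iter_noise_sqint k a b : sqint P (fun t => iter_noise k t a b).
Proof. by case: (adapted_iter_noise k a b). Qed.

Lemma iter_noise_mean0 k a b (h : T -> R) : pmeas (before k) h -> sqint P h ->
  \int[P]_t (h t * iter_noise k t a b) = 0.
Proof.
move=> mh sh; have [_ aw _] := adapted_iterates k.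
rewrite (@eq_RintegralT _ _ _ P (fun t => h t * noise a k (fun t => row a (ws k t)) t 0 b)).
  apply: (noise_orthogonal _ _ _ mh sh) => [|l]; first by rewrite /before /= ltnn.
  by case: (adapted_row a aw 0 l).
by move=> t _; rewrite noise_rowsE.
Qed.

(** The past is enlarged by the samples of iteration l at every node except a'. One argument then
    covers both an earlier iteration and another node of the same iteration. *)
Let iter_noise_orth_lt k l a a' b b' : (k < l)%N || (k == l) && (a != a') ->
  \int[P]_t (iter_noise k t a b * iter_noise l t a' b') = 0.
Proof.
move=> kl; pose S : set ('I_n * nat) :=
  [set il | (il.2 < l)%N || (il.2 == l) && (il.1 != a')].
have bS m : (m <= l)%N -> before m `<=` S.
  by move=> ml il /= ilm; rewrite /S /= (leq_trans ilm ml).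
have kle : (k <= l)%N by case/orP: kl => [/ltnW//|/andP[/eqP ->]].
have [_ aw _] := adapted_iterates k; have [_ aw' _] := adapted_iterates l.
rewrite (@eq_RintegralT _ _ _ P (fun t => noise a k (fun t => row a (ws k t)) t 0 b *
    noise a' l (fun t => row a' (ws l t)) t 0 b')); last first.
  by move=> t _; rewrite !noise_rowsE.
have mw c m (mM : (m <= l)%N) : forall j, pmeas S (fun t => row c (ws m t) 0 j).
  move=> j; have [_ awm _] := adapted_iterates m.
  by have [+ _] := adapted_row c awm 0 j; apply: past_sub; exact: bS.
apply: (@noise_orthogonal S).
- by rewrite /S /= ltnn !eqxx.
- exact: mw.
- by apply: pmeas_noise => //; exact: mw.
- apply: eq_sqint (iter_noise_sqint k a b) => t.
  by rewrite noise_rowsE.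
Qed.

Lemma iter_noise_orth k l a a' b b' : (k, a) != (l, a') ->
  \int[P]_t (iter_noise k t a b * iter_noise l t a' b') = 0.
Proof.
move=> kala; case: (ltngtP k l) => kl.
- by apply: iter_noise_orth_lt; rewrite kl.
- under eq_Rintegral do rewrite mulrC.
  by apply: iter_noise_orth_lt; rewrite kl.
- apply: iter_noise_orth_lt; rewrite kl ltnn eqxx /=.
  by apply: contraNN kala => /eqP ->; rewrite kl.
Qed.

Lemma iter_noise_variance k :
  \int[P]_t sqnorm (iter_noise k t) <= n%:R * sigma ^+ 2.
Proof.
have [_ aw _] := adapted_iterates k.
have Ni i : integ P (fun t => sqnorm (noise i k (fun t => row i (ws k t)) t)).
  apply: integ_sqnorm => c j; rewrite ord1.
  by apply: eq_sqint (iter_noise_sqint k i j) => t; rewrite noise_rowsE.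
rewrite (@eq_RintegralT _ _ _ P (fun t =>
    \sum_i sqnorm (noise i k (fun t => row i (ws k t)) t))); last first.
  move=> t _; rewrite {1}/sqnorm; apply: eq_bigr => i _.
  by rewrite sqnorm_row; apply: eq_bigr => j _; rewrite noise_rowsE.
rewrite Rintegral_sum//.
have -> : n%:R * sigma ^+ 2 = \sum_(i < n) sigma ^+ 2.
  by rewrite sumr_const card_ord mulr_natl.
apply: ler_sum => i _.
rewrite -lee_fin (Rintegral_fineK (Ni i)).
apply: (noise_variance (S := before k)) => [|l]; first by rewrite /before /= ltnn.
by case: (adapted_row i aw 0 l).
Qed.

(** Cross terms between nodes vanish, so averaging divides the total variance n sigma^2 by n^2. The
    factor 1 / sqrt(n) in the leading term of the rate originates here. *)
Lemma iter_noise_mean_variance k : (0 < n)%N ->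
  \int[P]_t sqnorm (row_mean (iter_noise k t)) <= sigma ^+ 2 / n%:R.
Proof.
move=> n0; have nR : 0 < n%:R :> R by rewrite ltr0n.
have sS b : sqint P (fun t => \sum_a iter_noise k t a b).
  by apply: sqint_sum => a _; exact: iter_noise_sqint.
rewrite (@eq_RintegralT _ _ _ P (fun t => n%:R ^- 2 * \sum_b (\sum_a iter_noise k t a b) ^+ 2)).
  2: { move=> t _; rewrite /row_mean sqnormZ exprVn sqnorm_row; congr (_ * _).
  apply: eq_bigr => b _; rewrite summxE; congr (_ ^+ 2).
  by apply: eq_bigr => a _; rewrite mxE. }
rewrite RintegralZl//; last by apply: integ_sum => b _; case: (sS b).
rewrite Rintegral_sum => [|b _]; last by case: (sS b).
have -> : \sum_b \int[P]_t ((\sum_a iter_noise k t a b) ^+ 2) =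
    \int[P]_t sqnorm (iter_noise k t).
  rewrite [RHS]Rintegral_sum => [|a _]; last first.
    by apply: integ_sum => b _; case: (iter_noise_sqint k a b).
  under [RHS]eq_bigr => a _.
    rewrite Rintegral_sum => [|b _]; last by case: (iter_noise_sqint k a b).
    over.
  rewrite exchange_big; apply: eq_bigr => b _.
  apply: Rintegral_sqr_sum => [a|a a' aa']; first exact: iter_noise_sqint.
  by apply: iter_noise_orth; apply: contraNN aa' => /eqP[->].
rewrite mulrC ler_pdivrMr ?exprn_gt0//.
apply: le_trans (iter_noise_variance k) _.
rewrite (_ : sigma ^+ 2 / _ * _ = n%:R * sigma ^+ 2)//.
by field; rewrite gt_eqF.
Qed.

Variable pi : 'cV[R]_n.
Hypotheses (W_ge0 : nonnegative_mx W) (W_col : column_stochastic W).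
Hypotheses (W_pi : is_equilibrium W pi) (beta_lt1 : beta_pi W pi < 1).

Local Notation kappa := (kappa_pi pi).
Local Notation beta := (beta_pi W pi).
Local Notation npi := (pi_sqnorm pi).

Lemma integ_pi_sqnorm S m (F : T -> 'M[R]_(n, m)) : adapted S F ->
  integ P (fun t => npi (F t)).
Proof.
move=> aF; apply: integ_sum => a _; apply: integ_sum => b _.
have [_ [_ sF]] := aF a b.
by apply: eq_integ (integZ (pi a 0)^-1 sF) => t; rewrite mulrC.
Qed.

Lemma Rintegral_pi_sqnorm S m (F : T -> 'M[R]_(n, m)) : adapted S F ->
  \int[P]_t npi (F t) = \sum_a \sum_b (pi a 0)^-1 * \int[P]_t (F t a b ^+ 2).
Proof.
move=> aF; have sF a b : integ P (fun t => F t a b ^+ 2) by have [_ [_ ?]] := aF a b.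
have sF' a b : integ P (fun t => F t a b ^+ 2 / pi a 0).
  by apply: eq_integ (integZ (pi a 0)^-1 (sF a b)) => t; rewrite mulrC.
rewrite /pi_sqnorm Rintegral_sum => [|a _]; last by apply: integ_sum => b _.
apply: eq_bigr => a _; rewrite Rintegral_sum//; apply: eq_bigr => b _.
under eq_Rintegral do rewrite mulrC.
by rewrite RintegralZl//; exact: sF.
Qed.

Lemma adapted_sum S (I : Type) (r : seq I) m p (F : I -> T -> 'M[R]_(m, p)) :
  (forall i, adapted S (F i)) -> adapted S (fun t => \sum_(i <- r) F i t).
Proof.
move=> aF; elim: r => [|i r IH].
  by apply: eq_adapted (adapted_cst S 0) => t; rewrite big_nil.
by apply: eq_adapted (adaptedD (aF i) IH) => t; rewrite big_cons.
Qed.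

(** The matrices mix the nodes within each entry, but for distinct iterations every pair of nodes is
    orthogonal. *)
Lemma iter_noise_mulmx_orth k l (A A' : 'M[R]_n) a b : k != l ->
  \int[P]_t ((A *m iter_noise k t) a b * (A' *m iter_noise l t) a b) = 0.
Proof.
move=> kl; rewrite (@eq_RintegralT _ _ _ P (fun t => \sum_c \sum_c'
    A a c * A' a c' * (iter_noise k t c b * iter_noise l t c' b))); last first.
  move=> t _; rewrite [(A *m _) a b]mxE [(A' *m _) a b]mxE mulr_suml.
  apply: eq_bigr => c _.
  by rewrite mulr_sumr; apply: eq_bigr => c' _; rewrite mulrACA.
have Icc c c' : integ P (fun t => iter_noise k t c b * iter_noise l t c' b).
  exact: integM (iter_noise_sqint _ _ _) (iter_noise_sqint _ _ _).
rewrite Rintegral_sum => [|c _]; last by apply: integ_sum => c' _; exact: integZ.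
rewrite big1// => c _; rewrite Rintegral_sum => [|c' _]; last exact: integZ.
rewrite big1// => c' _; rewrite RintegralZl//; last exact: Icc.
have kcl : (k, c) != (l, c') by apply: contraNN kl => /eqP[->].
by rewrite (iter_noise_orth b b kcl) mulr0.
Qed.

(** By orthogonality the squared kernel is summed, giving beta^2 times the sum of m^2 beta^(2m). The
    injection [tau] allows the same bound for the noise at j and at j + 1. *)
Lemma propagate_noise_le (tau : nat -> nat) k : injective tau ->
  \int[P]_t npi (propagate W pi k (fun j => iter_noise (tau j) t)) <=
  2 * beta ^+ 4 / (1 - beta) ^+ 3 * (n%:R ^+ 2 * kappa * sigma ^+ 2).
Proof.
move=> tau_inj.
have beta0 : 0 <= beta := beta_ge0 W pi.
pose A (j : 'I_k) : 'M[R]_n := (k.-1 - j)%:R *: mixing_dev W pi ^+ (k - j).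
pose Z (j : 'I_k) t := A j *m iter_noise (tau j) t.
have aZ (j : 'I_k) : adapted setT (Z j).
  by apply: adapted_mulmx; apply: adapted_sub (adapted_iter_noise (tau j)).
have -> : \int[P]_t npi (propagate W pi k (fun j => iter_noise (tau j) t)) =
    \sum_(j < k) \int[P]_t npi (Z j t).
  rewrite (@eq_RintegralT _ _ _ P (fun t => npi (\sum_(j < k) Z j t))).
    rewrite (Rintegral_pi_sqnorm (adapted_sum _ aZ)).
    under [RHS]eq_bigr do rewrite (Rintegral_pi_sqnorm (aZ _)).
    rewrite [RHS]exchange_big; apply: eq_bigr => a _.
    rewrite [RHS]exchange_big; apply: eq_bigr => b _ /=.
    rewrite -mulr_sumr; congr (_ * _).
    under eq_Rintegral do rewrite summxE.
    apply: (@Rintegral_sqr_sum _ _ _ P _ (fun j t => Z j t a b)) => [j|i j ij].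
      by case: (aZ j a b).
    apply: iter_noise_mulmx_orth; apply: contraNN ij => /eqP /tau_inj ij.
    by apply/eqP/val_inj.
  move=> t _; rewrite /propagate; congr npi; apply: eq_bigr => j _.
  by rewrite /Z /A scalemxAl.
have c0 : 0 <= n%:R ^+ 2 * kappa * sigma ^+ 2.
  apply: mulr_ge0 (sqr_ge0 _); apply: mulr_ge0 (sqr_ge0 _) _.
  exact: ltW (kappa_gt0 W_pi).
have step (j : 'I_k) : \int[P]_t npi (Z j t) <=
    ((k.-1 - j)%:R * beta ^+ (k - j)) ^+ 2 * (n%:R ^+ 2 * kappa * sigma ^+ 2).
  have nk0 : 0 <= n%:R * kappa by apply: mulr_ge0 (ltW (kappa_gt0 W_pi)).
  have Is : integ P (fun t => sqnorm (iter_noise (tau j) t)).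
    by apply: integ_sqnorm => a b; exact: iter_noise_sqint.
  apply: le_trans (_ : \int[P]_t (((k.-1 - j)%:R * beta ^+ (k - j)) ^+ 2 *
      (n%:R * kappa) * sqnorm (iter_noise (tau j) t)) <= _).
    apply: le_Rintegral => //; [exact: integ_pi_sqnorm (aZ j)|exact: integZ|].
    move=> t _; rewrite /Z /A -scalemxAl.
    apply: le_trans (propagate_term_le W_pi _ _ _) _.
    by rewrite -mulrA ler_wpM2l ?sqr_ge0// (pi_sqnorm_le W_pi).
  rewrite RintegralZl// -mulrA ler_wpM2l ?sqr_ge0//.
  apply: le_trans (ler_wpM2l nk0 (iter_noise_variance (tau j))) _.
  by rewrite le_eqVlt; apply/orP; left; apply/eqP; ring.
apply: le_trans (ler_sum _ (fun j _ => step j)) _.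
rewrite -mulr_suml ler_wpM2r//.
pose a m : R := m%:R ^+ 2 * (beta ^+ 2) ^+ m.+1.
have -> : \sum_(j < k) ((k.-1 - j)%:R * beta ^+ (k - j)) ^+ 2 = \sum_(m < k) a m.
  rewrite -(sum_rev_ord a); apply: eq_bigr => j _.
  by rewrite subn_ord_predS exprMn /a -!exprM mulnC.
have -> : \sum_(m < k) a m = beta ^+ 2 * \sum_(m < k) m%:R ^+ 2 * (beta ^+ 2) ^+ m.
  by rewrite mulr_sumr; apply: eq_bigr => m _; rewrite /a [_ ^+ m.+1]exprS mulrCA.
have b' : 0 < 1 - beta by rewrite subr_gt0.
have b2 : 0 <= beta ^+ 2 < 1 by rewrite sqr_ge0 exprn_ilt1.
have bb2 : 1 - beta <= 1 - beta ^+ 2.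
  by rewrite lerD2l lerN2 expr2 ler_piMl// ltW.
apply: le_trans (ler_wpM2l (sqr_ge0 _) (sum_natM2_geom_le k b2)) _.
have -> : 2 * beta ^+ 4 / (1 - beta) ^+ 3 =
    beta ^+ 2 * (2 * beta ^+ 2 / (1 - beta) ^+ 3) by ring.
rewrite ler_wpM2l ?sqr_ge0// ler_wpM2l//; first exact: mulr_ge0 (ler0n _ _) (sqr_ge0 _).
rewrite lef_pV2 ?posrE ?exprn_gt0//; last exact: lt_le_trans bb2.
by rewrite ler_pXn2r ?nnegrE ?(ltW b')// (le_trans (ltW b') bb2).
Qed.

(** * The estimate in expectation *)

Section Expectation.
Variable Delta : R.
Hypothesis f_gap : forall x, average f x0 - average f x <= Delta.
Hypotheses (gamma_gt0 : 0 < gamma) (gamma_L : gamma * L <= 1 / 2).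
Hypothesis gamma_beta : 40 * (gamma * L) * kappa ^+ 7 * beta <= (1 - beta) ^+ 2.

Local Notation xbar k t := (row_mean (pd_x (st t k))).
Local Notation F := (average f).

Lemma adapted_row_mean S m (z : T -> 'M[R]_(n, m)) : adapted S z ->
  adapted S (fun t => row_mean (z t)).
Proof.
move=> az; apply: eq_adapted (adaptedZ n%:R^-1 (adapted_mulmx (const_mx 1) az)) => t.
by rewrite row_meanE.
Qed.

Lemma adapted_grad_xbar k : adapted (before k) (fun t => grad F (xbar k t)).
Proof.
have [ax _ _] := adapted_iterates k; have axb := adapted_row_mean ax.
apply: eq_adapted (adaptedZ n%:R^-1 (adapted_sum (index_enum 'I_n)
  (fun i => adapted_grad i axb))) => t.
by rewrite grad_average// => i; case: (f_smooth i).
Qed.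

Lemma integ_grad_xbar k : integ P (fun t => sqnorm (grad F (xbar k t))).
Proof. by apply: integ_sqnorm => a b; case: (adapted_grad_xbar k a b). Qed.

Let integ_dot k j :
  integ P (fun t => grad F (xbar k t) 0 j * row_mean (iter_noise k t) 0 j).
Proof.
apply: integM; first by case: (adapted_grad_xbar k 0 j).
by case: (adapted_row_mean (adapted_iter_noise k) 0 j).
Qed.

Let Rintegral_dot k :
  \int[P]_t dotr (grad F (xbar k t)) (row_mean (iter_noise k t)) = 0.
Proof.
rewrite /dotr Rintegral_sum => [|j _]; last exact: integ_dot.
rewrite big1// => j _; have [mg sg] := adapted_grad_xbar k 0 j.
rewrite (@eq_RintegralT _ _ _ P (fun t => n%:R^-1 *
    \sum_a grad F (xbar k t) 0 j * iter_noise k t a j)); last first.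
  move=> t _; rewrite [X in _ * X]mxE summxE mulrCA mulr_sumr; congr (_ * _).
  by apply: eq_bigr => a _; rewrite [row a _ _ _]mxE.
have Ia a : integ P (fun t => grad F (xbar k t) 0 j * iter_noise k t a j).
  exact: integM sg (iter_noise_sqint k a j).
rewrite RintegralZl//; last exact: integ_sum.
rewrite Rintegral_sum// big1 ?mulr0// => a _.
exact: iter_noise_mean0 mg sg.
Qed.

(** The linear term vanishes because the gradient at [xbar k] depends on samples before k only. The
    constant is 36 = 9 * 2 * 2, for two noise sequences with a bound of leading factor 2 each; the
    factors n^2 cancel. *)
Lemma expected_estimate K :
  \sum_(k < K.+1) \int[P]_t sqnorm (grad F (xbar k t)) <=
  2 * Delta / gamma + 4 * (gamma * L) * (K.+1%:R * (sigma ^+ 2 / n%:R))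
  + \int[P]_t sqnorm (pd_y (st t 0))
  + K.+1%:R * (36 * (gamma * L) ^+ 2 * kappa ^+ 3 *
      (beta ^+ 4 / (1 - beta) ^+ 3) * sigma ^+ 2).
Proof.
have n0 := equilibrium_dim_gt0 W_pi; have nR := equilibrium_dimR_gt0 W_pi.
pose sbar k t := row_mean (iter_noise k t).
pose D t := \sum_(k < K.+1) dotr (grad F (xbar k t)) (sbar k t).
pose V t := \sum_(k < K.+1) sqnorm (sbar k t).
pose Y t := sqnorm (pd_y (st t 0)).
pose Q k t := npi (propagate W pi k (fun j => iter_noise j.+1 t)) +
  npi (propagate W pi k (fun j => iter_noise j t)).
pose c := 9 * (gamma * L) ^+ 2 * kappa ^+ 2 / n%:R ^+ 2.
have c0 : 0 <= c.
  apply: divr_ge0 (sqr_ge0 _); apply: mulr_ge0 (sqr_ge0 _).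
  exact: mulr_ge0 (ler0n _ _) (sqr_ge0 _).
have ID : integ P D by apply: integ_sum => k _; apply: integ_sum => j _.
have IV : integ P V.
  apply: integ_sum => k _; apply: integ_sqnorm => a b.
  by case: (adapted_row_mean (adapted_iter_noise k) a b).
have IY : integ P Y.
  have [_ _ ay] := adapted_iterates 0.
  by apply: integ_sqnorm => a b; case: (ay a b).
have aP k (tau : nat -> nat) :
    adapted setT (fun t => propagate W pi k (fun j => iter_noise (tau j) t)).
  apply: adapted_sum => j; apply: adaptedZ; apply: adapted_mulmx.
  exact: adapted_sub (adapted_iter_noise (tau j)).
have IQ1 k : integ P (fun t => npi (propagate W pi k (fun j => iter_noise j.+1 t))).
  exact: integ_pi_sqnorm (aP k succn).
have IQ2 k : integ P (fun t => npi (propagate W pi k (fun j => iter_noise j t))).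
  exact: integ_pi_sqnorm (aP k id).
have IQ k : integ P (Q k) by exact: integD.
have ISQ : integ P (fun t => \sum_(k < K.+1) Q k t) by apply: integ_sum => k _.
rewrite -Rintegral_sum => [|k _]; last exact: integ_grad_xbar.
have I1 := integB (integ_cst P (2 * Delta / gamma)) (integZ 2 ID).
have I2 := integD I1 (integZ (4 * (gamma * L)) IV).
have I3 := integD I2 IY.
apply: le_trans (_ : \int[P]_t (2 * Delta / gamma - 2 * D t + 4 * (gamma * L) * V t +
    Y t + c * \sum_(k < K.+1) Q k t) <= _).
  apply: le_Rintegral => //.
  - by apply: integ_sum => k _; exact: integ_grad_xbar.
  - exact: integD I3 (integZ c ISQ).
  - move=> t _; exact: (pointwise_estimate (g t) W_ge0 W_col W_pi beta_lt1 L_gt0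
      f_smooth f_gap gamma_gt0 gamma_L gamma_beta K).
rewrite (RintegralD measurableT I3 (integZ c ISQ)).
rewrite (RintegralD measurableT I2 IY).
rewrite (RintegralD measurableT I1 (integZ (4 * (gamma * L)) IV)).
rewrite (RintegralB measurableT (integ_cst P (2 * Delta / gamma)) (integZ 2 ID)).
rewrite (RintegralZl _ measurableT ID) (RintegralZl _ measurableT IV).
rewrite (RintegralZl _ measurableT ISQ) Rintegral_cst_probability.
have -> : \int[P]_t D t = 0.
  rewrite Rintegral_sum => [|k _]; last by apply: integ_sum => j _.
  by rewrite big1.
have VE : \int[P]_t V t <= K.+1%:R * (sigma ^+ 2 / n%:R).
  rewrite Rintegral_sum => [|k _]; last first.
    apply: integ_sqnorm => a b.
    by case: (adapted_row_mean (adapted_iter_noise k) a b).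
  have -> : K.+1%:R * (sigma ^+ 2 / n%:R) = \sum_(k < K.+1) sigma ^+ 2 / n%:R.
    by rewrite sumr_const card_ord mulr_natl.
  by apply: ler_sum => k _; exact: iter_noise_mean_variance.
pose q := 2 * beta ^+ 4 / (1 - beta) ^+ 3 * (n%:R ^+ 2 * kappa * sigma ^+ 2).
have QE : \int[P]_t (\sum_(k < K.+1) Q k t) <= K.+1%:R * (2 * q).
  rewrite Rintegral_sum//.
  have -> : K.+1%:R * (2 * q) = \sum_(k < K.+1) 2 * q.
    by rewrite sumr_const card_ord mulr_natl.
  apply: ler_sum => k _; rewrite (RintegralD measurableT (IQ1 k) (IQ2 k)).
  have h1 := propagate_noise_le k succn_inj.
  have h2 := propagate_noise_le k (@inj_id nat).
  by rewrite mulr_natl mulr2n; exact: lerD h1 h2.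
have gL0 : 0 <= 4 * (gamma * L).
  exact: mulr_ge0 (ler0n _ _) (mulr_ge0 (ltW gamma_gt0) (ltW L_gt0)).
have h1 := ler_wpM2l gL0 VE; have h2 := ler_wpM2l c0 QE.
have cq : c * (K.+1%:R * (2 * q)) = K.+1%:R * (36 * (gamma * L) ^+ 2 * kappa ^+ 3 *
      (beta ^+ 4 / (1 - beta) ^+ 3) * sigma ^+ 2).
  have b0 : 1 - beta != 0 by rewrite gt_eqF// subr_gt0.
  rewrite /c /q; move: b0; move: (kappa) (beta) => kap bet b0; field.
  by rewrite b0 gt_eqF.
rewrite cq in h2; rewrite mulr0 subr0.
by rewrite !lerD.
Qed.

End Expectation.
End Iterates.
End Lipschitz.
End Oracle.

(** * The step size and the rate *)

Section RateBound.
Variable R : realType.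

Local Ltac nneg := repeat first [exact: ler0n | done | by apply: ltW | exact: powR_ge0 |
  apply: exprn_ge0 | apply: divr_ge0 | apply: mulr_ge0].

Lemma powR_div_exp (x : R) (p q : nat) : 0 <= x -> (0 < q)%N ->
  (x `^ (p%:R / q%:R)) ^+ q = x ^+ p.
Proof.
move=> x0 q0; rewrite -powR_mulrn ?powR_ge0// -powRrM divfK ?powR_mulrn//.
by rewrite pnatr_eq0 -lt0n.
Qed.

Lemma powR_root_exp (x : R) (q : nat) : 0 <= x -> (0 < q)%N ->
  (x `^ (1 / q%:R)) ^+ q = x.
Proof. by move=> x0 q0; have := powR_div_exp 1 x0 q0; rewrite expr1. Qed.

(** From (1 + m)^q >= 1 + m >= m. Taking 1 + m in place of the q-th root of m keeps roots out of the
    final constant. *)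
Lemma le_of_exp_le (t m r : R) q : (0 < q)%N -> 0 <= t -> 0 <= m -> 0 <= r ->
  t ^+ q <= m * r ^+ q -> t <= (1 + m) * r.
Proof.
move=> q0 t0 m0 r0 le1.
have m1 : 1 <= 1 + m by rewrite lerDl.
rewrite -(@ler_pXn2r _ q) ?nnegrE//; last first.
  by rewrite mulr_ge0// (le_trans ler01).
apply: le_trans le1 _; rewrite exprMn ler_wpM2r ?exprn_ge0//.
apply: le_trans (_ : 1 + m <= _); first by rewrite lerDr.
by rewrite ler_eXnr.
Qed.

Section StepSize.
Variables (n K : nat) (L Delta sigma beta kappa Y : R).
Hypotheses (n0 : (0 < n)%N) (K0 : (0 < K)%N) (L0 : 0 < L) (Delta0 : 0 < Delta).
Hypotheses (sigma0 : 0 <= sigma) (beta0 : 0 <= beta) (beta1 : beta < 1).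
Hypotheses (kappa1 : 1 <= kappa) (Y0 : 0 <= Y).

Let b' : 0 < 1 - beta. Proof. by rewrite subr_gt0. Qed.
Let k0 : 0 < kappa. Proof. exact: lt_le_trans ltr01 kappa1. Qed.
Let nR : 0 < n%:R :> R. Proof. by rewrite ltr0n. Qed.
Let n1 : 1 <= n%:R :> R. Proof. by rewrite ler1n. Qed.
Let KR : 0 < K%:R :> R. Proof. by rewrite ltr0n. Qed.
Let K1R : 0 < K.+1%:R :> R. Proof. by rewrite ltr0n. Qed.
Let KK1 : K%:R <= K.+1%:R :> R. Proof. by rewrite ler_nat. Qed.

Local Notation gamma := (step_size n K L Delta sigma beta kappa Y).
Let a1 := (gamma1 n K L Delta sigma)^-1.
Let a2 := (gamma2 K L Delta sigma beta kappa)^-1.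
Let a3 := (gamma3 n K L Delta sigma beta kappa)^-1.
Let a4 := (gamma4 L Delta beta kappa Y)^-1.
Let a5 := (gamma5 L beta kappa)^-1.
Let a6 := (gamma6 L)^-1.

Let a1_ge0 : 0 <= a1. Proof. by rewrite invr_ge0 powR_ge0. Qed.
Let a2_ge0 : 0 <= a2. Proof. by rewrite invr_ge0 powR_ge0. Qed.
Let a3_ge0 : 0 <= a3. Proof. by rewrite invr_ge0 powR_ge0. Qed.
Let a4_ge0 : 0 <= a4. Proof. by rewrite invr_ge0 powR_ge0. Qed.

Let a5E : a5 = 40 * L * kappa ^+ 7 * beta / (1 - beta) ^+ 2.
Proof. by rewrite /a5 /gamma5 invf_div. Qed.

Let a5_ge0 : 0 <= a5.
Proof.
rewrite a5E divr_ge0 ?sqr_ge0// mulr_ge0// mulr_ge0 ?exprn_ge0 ?(ltW k0)//.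
by rewrite mulr_ge0// ltW.
Qed.

Let a6E : a6 = 2 * L. Proof. by rewrite /a6 /gamma6 invf_div divr1. Qed.

Let a6_gt0 : 0 < a6. Proof. by rewrite a6E mulr_gt0. Qed.

Let gammaV : gamma^-1 = a1 + a2 + a3 + a4 + a5 + a6.
Proof. by rewrite invrK. Qed.

Lemma step_size_gt0 : 0 < gamma.
Proof. by rewrite -invr_gt0 gammaV ltr_wpDl// !addr_ge0. Qed.

Let gamma_le a : 0 <= a -> a <= gamma^-1 -> gamma * a <= 1.
Proof. by move=> a0 aV; rewrite mulrC -ler_pdivlMr ?step_size_gt0// div1r. Qed.

Lemma step_size_L : gamma * L <= 1 / 2.
Proof.
have : gamma * a6 <= 1.
  by apply: gamma_le; [exact: ltW|rewrite gammaV lerDr !addr_ge0].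
by rewrite a6E; lra.
Qed.

Lemma step_size_beta : 40 * (gamma * L) * kappa ^+ 7 * beta <= (1 - beta) ^+ 2.
Proof.
have : gamma * a5 <= 1.
  apply: gamma_le => //; rewrite gammaV.
  have := ltW a6_gt0; move: a1_ge0 a2_ge0 a3_ge0 a4_ge0; lra.
rewrite a5E mulrA ler_pdivrMr ?exprn_gt0// mul1r; apply: le_trans.
by rewrite le_eqVlt; apply/orP; left; apply/eqP; ring.
Qed.

(** This identity and the three that follow also hold when the denominator in gamma_i vanishes, both
    sides then being 0, so no case distinction on sigma, beta or Y arises. *)
Let a1X : a1 ^+ 2 = K.+1%:R * L * sigma ^+ 2 / (2 * n%:R * Delta).
Proof.
by rewrite exprVn powR_root_exp ?invf_div//; nneg.
Qed.

Let a2X : a2 ^+ 3 = 2 * K.+1%:R * L ^+ 2 * kappa ^+ 6 * beta ^+ 4 * sigma ^+ 2 /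
  (Delta * (1 - beta) ^+ 3).
Proof.
by rewrite exprVn powR_root_exp ?invf_div//; nneg.
Qed.

Let a3X : a3 ^+ 5 = 1200 * K.+1%:R * L ^+ 4 * kappa ^+ 8 * beta ^+ 4 * sigma ^+ 2 /
  (n%:R ^+ 2 * Delta * (1 - beta) ^+ 4).
Proof.
rewrite /a3 /gamma3; move: (1200 : R) (ler0n R 1200) => c c0.
by rewrite exprVn powR_root_exp ?invf_div//; nneg.
Qed.

Let a4X : a4 ^+ 3 = 4 * L ^+ 2 * kappa ^+ 4 * beta ^+ 2 * Y / ((1 - beta) ^+ 2 * Delta).
Proof.
by rewrite exprVn powR_root_exp ?invf_div//; nneg.
Qed.

Let rho1 := sigma / Num.sqrt (n%:R * K%:R).
Let rho2 := beta `^ (4 / 3) * kappa ^+ 2 * sigma `^ (2 / 3) /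
  ((1 - beta) * K%:R `^ (2 / 3)).
Let rho3 := kappa ^+ 7 * beta / ((1 - beta) ^+ 2 * K%:R).
Let rho4 : R := 1 / K%:R.

Let rho1X : rho1 ^+ 2 = sigma ^+ 2 / (n%:R * K%:R).
Proof. by rewrite exprMn exprVn sqr_sqrtr// mulr_ge0. Qed.

Let rho2X : rho2 ^+ 3 = beta ^+ 4 * kappa ^+ 6 * sigma ^+ 2 /
  ((1 - beta) ^+ 3 * K%:R ^+ 2).
Proof.
rewrite exprMn exprVn !exprMn !powR_div_exp//.
by congr (_ / _); ring.
Qed.

Let rho1_ge0 : 0 <= rho1. Proof. by rewrite divr_ge0// sqrtr_ge0. Qed.
Let rho2_ge0 : 0 <= rho2.
Proof. by rewrite /rho2; nneg. Qed.
Let rho3_ge0 : 0 <= rho3.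
Proof. by rewrite /rho3; nneg. Qed.
Let rho4_ge0 : 0 <= rho4. Proof. by rewrite divr_ge0. Qed.

(** The share of the summand [a] of 1 / gamma in Delta / (gamma (K + 1)). *)
Let T a : R := Delta * a / K.+1%:R.

Let T_ge0 a : 0 <= a -> 0 <= T a. Proof. by move=> a0; rewrite /T; nneg. Qed.

Let T1_le : T a1 <= (1 + Delta * L / 2) * rho1.
Proof.
apply: (@le_of_exp_le _ _ _ 2) => //; [exact: T_ge0|by nneg|].
have -> : T a1 ^+ 2 = Delta * L / 2 * (sigma ^+ 2 / (n%:R * K.+1%:R)).
  rewrite /T exprMn exprVn exprMn a1X; field.
  by rewrite !gt_eqF.
rewrite rho1X ler_wpM2l//; first by nneg.
rewrite ler_wpM2l ?sqr_ge0// lef_pV2 ?posrE ?mulr_gt0//.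
by rewrite ler_wpM2l// ltW.
Qed.

Let T2_le : T a2 <= (1 + 2 * Delta ^+ 2 * L ^+ 2) * rho2.
Proof.
apply: (@le_of_exp_le _ _ _ 3) => //; [exact: T_ge0|by nneg|].
have -> : T a2 ^+ 3 = 2 * Delta ^+ 2 * L ^+ 2 *
    (beta ^+ 4 * kappa ^+ 6 * sigma ^+ 2 / ((1 - beta) ^+ 3 * K.+1%:R ^+ 2)).
  rewrite /T exprMn exprVn exprMn a2X; field.
  by rewrite !gt_eqF.
rewrite rho2X ler_wpM2l//; first by nneg.
rewrite ler_wpM2l//; first by nneg.
rewrite lef_pV2 ?posrE ?mulr_gt0 ?exprn_gt0// ler_wpM2l ?exprn_ge0 ?(ltW b')//.
by rewrite ler_pXn2r ?nnegrE ?(ltW KR) ?(ltW K1R).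
Qed.

Let u := kappa ^+ 7 * beta / (1 - beta) ^+ 2.

Let u_ge0 : 0 <= u. Proof. by rewrite /u; nneg. Qed.

Let rho3E : rho3 = u / K%:R.
Proof. by rewrite /rho3 /u; field; rewrite !gt_eqF. Qed.

Let sqr_le_u : kappa ^+ 4 * beta ^+ 2 / (1 - beta) ^+ 2 <= u.
Proof.
rewrite /u ler_wpM2r ?invr_ge0 ?sqr_ge0//.
apply: ler_pM; rewrite ?exprn_ge0 ?(ltW k0)//; first exact: ler_weXn2l.
by rewrite expr2 ler_piMl// ltW.
Qed.

Let c1200 : R := 1200.
Let c1200_ge0 : 0 <= c1200. Proof. exact: ler0n. Qed.

(** The rate has no term for gamma3. The fifth power is at most a constant times rho1^2 rho3^2 rho4,
    an interpolation of three existing terms, and each of the five factors is at most their sum. *)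
Let T3_le : T a3 <= (1 + c1200 * Delta ^+ 4 * L ^+ 4) * (rho1 + rho3 + rho4).
Proof.
apply: (@le_of_exp_le _ _ _ 5) => //; [exact: T_ge0|by nneg|by rewrite !addr_ge0|].
have -> : T a3 ^+ 5 = c1200 * Delta ^+ 4 * L ^+ 4 * (sigma ^+ 2 / (n%:R ^+ 2) *
    (kappa ^+ 4 * beta ^+ 2 / (1 - beta) ^+ 2) ^+ 2 / K.+1%:R ^+ 4).
  rewrite /T exprMn exprVn exprMn a3X -/c1200; move: c1200 => c; field.
  by rewrite !gt_eqF.
rewrite ler_wpM2l//; first by nneg.
apply: le_trans (_ : rho1 ^+ 2 * rho3 ^+ 2 * rho4 <= _).
  rewrite rho1X rho3E /rho4.
  have -> : sigma ^+ 2 / (n%:R * K%:R) * (u / K%:R) ^+ 2 * (1 / K%:R) =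
      sigma ^+ 2 / n%:R * u ^+ 2 / K%:R ^+ 4 by field; rewrite !gt_eqF.
  apply: ler_pM; rewrite ?invr_ge0 ?exprn_ge0//; first by nneg.
    apply: ler_pM; rewrite ?divr_ge0 ?sqr_ge0//.
      rewrite ler_wpM2l ?sqr_ge0// lef_pV2 ?posrE ?exprn_gt0//.
      by rewrite expr2 ler_peMl// ltW.
    rewrite ler_pXn2r ?nnegrE//; by nneg.
  by rewrite lef_pV2 ?posrE ?exprn_gt0// ler_pXn2r ?nnegrE ?(ltW KR) ?(ltW K1R).
set rho := rho1 + rho3 + rho4.
have rho_ge0 : 0 <= rho by rewrite !addr_ge0.
have h1 : rho1 <= rho by rewrite /rho -addrA lerDl addr_ge0.
have h3 : rho3 <= rho by rewrite /rho addrAC lerDr addr_ge0.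
have h4 : rho4 <= rho by rewrite /rho lerDr addr_ge0.
rewrite (exprD _ 4 1) expr1 (exprD _ 2 2); apply: ler_pM => //; first by nneg.
by apply: ler_pM; rewrite ?exprn_ge0// ler_pXn2r ?nnegrE.
Qed.

(** Interpolation as for gamma3, now with third powers and the product rho3 rho4^2. *)
Let T4_le : T a4 <= (1 + 4 * Delta ^+ 2 * L ^+ 2 * Y) * (rho3 + rho4).
Proof.
apply: (@le_of_exp_le _ _ _ 3) => //; [exact: T_ge0|by nneg|by rewrite !addr_ge0|].
have -> : T a4 ^+ 3 = 4 * Delta ^+ 2 * L ^+ 2 * Y *
    (kappa ^+ 4 * beta ^+ 2 / (1 - beta) ^+ 2 / K.+1%:R ^+ 3).
  rewrite /T exprMn exprVn exprMn a4X; field.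
  by rewrite !gt_eqF.
rewrite ler_wpM2l//; first by nneg.
apply: le_trans (_ : rho3 * rho4 ^+ 2 <= _).
  have -> : rho3 * rho4 ^+ 2 = u / K%:R ^+ 3.
    by rewrite rho3E /rho4; field; rewrite !gt_eqF.
  apply: ler_pM => //; first by nneg.
  by rewrite lef_pV2 ?posrE ?exprn_gt0// ler_pXn2r ?nnegrE ?(ltW KR) ?(ltW K1R).
have s0 : 0 <= rho3 + rho4 by rewrite addr_ge0.
have h3 : rho3 <= rho3 + rho4 by rewrite lerDl.
have h4 : rho4 ^+ 2 <= (rho3 + rho4) ^+ 2 by rewrite ler_pXn2r ?nnegrE// lerDr.
by rewrite [leRHS]exprS ler_pM// sqr_ge0.
Qed.

Let invK1 : K.+1%:R^-1 <= rho4.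
Proof. by rewrite /rho4 div1r lef_pV2 ?posrE. Qed.

Let T5_le : T a5 <= 40 * Delta * L * rho3.
Proof.
have -> : T a5 = 40 * Delta * L * (u * K.+1%:R^-1).
  by rewrite /T a5E /u; field; rewrite !gt_eqF.
have -> : rho3 = u * rho4 by rewrite rho3E /rho4 div1r.
by rewrite ler_wpM2l//; [nneg|rewrite ler_wpM2l].
Qed.

Let T6_le : T a6 <= 2 * Delta * L * rho4.
Proof.
have -> : T a6 = 2 * Delta * L * K.+1%:R^-1 by rewrite /T a6E; ring.
by rewrite ler_wpM2l//; nneg.
Qed.

(** Each [T] bound counts twice, from 2 Delta / (gamma (K + 1)). The first two count 8 and 18 times
    more for the noise terms, hence 10 and 20; 80 and 4 double the constants 40 and 2 of gamma5 and
    gamma6. *)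
Definition rate_constant : R :=
  10 * (1 + Delta * L / 2) + 20 * (1 + 2 * Delta ^+ 2 * L ^+ 2)
  + 2 * (1 + 1200 * Delta ^+ 4 * L ^+ 4) + 2 * (1 + 4 * Delta ^+ 2 * L ^+ 2 * Y)
  + 80 * Delta * L + 4 * Delta * L + Y.

Lemma rate_bound :
  2 * Delta / (gamma * K.+1%:R) + 4 * (gamma * L) * (sigma ^+ 2 / n%:R)
  + 36 * (gamma * L) ^+ 2 * kappa ^+ 3 * (beta ^+ 4 / (1 - beta) ^+ 3) * sigma ^+ 2
  + Y / K.+1%:R <= rate_constant * rate n K sigma beta kappa.
Proof.
have g0 := step_size_gt0.
have ga1 : gamma * a1 <= 1.
  apply: gamma_le => //; rewrite gammaV.
  by have := ltW a6_gt0; move: a2_ge0 a3_ge0 a4_ge0 a5_ge0; lra.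
have ga2 : gamma * a2 <= 1.
  apply: gamma_le => //; rewrite gammaV.
  by have := ltW a6_gt0; move: a1_ge0 a3_ge0 a4_ge0 a5_ge0; lra.
have t0 : 2 * Delta / (gamma * K.+1%:R) =
    2 * (T a1 + T a2 + T a3 + T a4 + T a5 + T a6).
  rewrite invfM gammaV /T; ring.
(* The noise terms reduce to the same shares: this one equals 8 [T a1] times gamma a1 <= 1, and the
   next is at most 18 [T a2] times (gamma a2)^2. *)
have t1 : 4 * (gamma * L) * (sigma ^+ 2 / n%:R) <= 8 * T a1.
  have -> : 4 * (gamma * L) * (sigma ^+ 2 / n%:R) = 8 * T a1 * (gamma * a1).
    rewrite (_ : 8 * T a1 * (gamma * a1) = 8 * Delta / K.+1%:R * gamma * a1 ^+ 2).
      by rewrite a1X; field; rewrite !gt_eqF.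
    by rewrite /T; ring.
  by rewrite ler_piMr// mulr_ge0// T_ge0.
have t2 : 36 * (gamma * L) ^+ 2 * kappa ^+ 3 * (beta ^+ 4 / (1 - beta) ^+ 3) *
    sigma ^+ 2 <= 18 * T a2.
  apply: le_trans (_ : 36 * (gamma * L) ^+ 2 * kappa ^+ 6 *
      (beta ^+ 4 / (1 - beta) ^+ 3) * sigma ^+ 2 <= _).
    rewrite ler_wpM2r ?sqr_ge0// ler_wpM2r//; first by nneg.
    have k36 : kappa ^+ 3 <= kappa ^+ 6 by exact: ler_weXn2l.
    by apply: ler_wpM2l k36; apply: mulr_ge0 => //; exact: sqr_ge0.
  have -> : 36 * (gamma * L) ^+ 2 * kappa ^+ 6 *
      (beta ^+ 4 / (1 - beta) ^+ 3) * sigma ^+ 2 = 18 * T a2 * (gamma * a2) ^+ 2.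
    rewrite (_ : 18 * T a2 * (gamma * a2) ^+ 2 =
      18 * Delta / K.+1%:R * gamma ^+ 2 * a2 ^+ 3).
      by rewrite a2X; field; rewrite !gt_eqF.
    by rewrite /T; ring.
  apply: ler_piMr; first exact: mulr_ge0 (ler0n _ _) (T_ge0 a2_ge0).
  by apply: exprn_ile1 => //; exact: mulr_ge0 (ltW g0) a2_ge0.
have t3 : Y / K.+1%:R <= Y * rho4 by rewrite ler_wpM2l.
rewrite /rate -/rho1 -/rho2 -/rho3 -/rho4 /rate_constant -/c1200.
have dl : 0 <= Delta * L by rewrite mulr_ge0 ?ltW.
have e1 : 0 <= c1200 * Delta ^+ 4 * L ^+ 4 by nneg.
have e2 : 0 <= 2 * Delta ^+ 2 * L ^+ 2 by nneg.
have e4 : 0 <= 4 * Delta ^+ 2 * L ^+ 2 * Y by nneg.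
move: t0 t1 t2 t3 T1_le T2_le T3_le T4_le T5_le T6_le => -> t1 t2 t3.
set x1 := T a1; set x2 := T a2; set x3 := T a3; set x4 := T a4.
set x5 := T a5; set x6 := T a6 => h1 h2 h3 h4 h5 h6.
set d := Delta * L in dl h1 *; set m3 := c1200 * _ * _ in e1 h3 *.
set m2 := 2 * _ * _ in e2 h2 *; set m4 := 4 * _ * _ * _ in e4 h4 *.
have r0 := (rho1_ge0, rho2_ge0, rho3_ge0, rho4_ge0).
(* The product of [rate_constant] and [rate] pairs every coefficient with all four terms of the
   rate; the pairs beyond the bounds above are dropped as nonnegative. *)
have m1r : 0 <= (1 + d / 2) * (rho2 + rho3 + rho4).
  by rewrite mulr_ge0 ?addr_ge0 ?r0// divr_ge0.
have m2r : 0 <= (1 + m2) * (rho1 + rho3 + rho4) by rewrite mulr_ge0 ?addr_ge0 ?r0.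
have m3r : 0 <= (1 + m3) * rho2 by rewrite mulr_ge0 ?addr_ge0 ?r0.
have m4r : 0 <= (1 + m4) * (rho1 + rho2) by rewrite mulr_ge0 ?addr_ge0 ?r0.
have m5r : 0 <= d * (rho1 + rho2 + rho4) by rewrite mulr_ge0 ?addr_ge0 ?r0.
have m6r : 0 <= d * (rho1 + rho2 + rho3) by rewrite mulr_ge0 ?addr_ge0 ?r0.
have m7r : 0 <= Y * (rho1 + rho2 + rho3) by rewrite mulr_ge0 ?addr_ge0 ?r0.
rewrite -![_ * Delta * L]mulrA -/d in h5 h6 *.
rewrite -/x1 in t1; rewrite -/x2 in t2.
move: t1 t2 t3 h1 h2 h3 h4 h5 h6 m1r m2r m3r m4r m5r m6r m7r.
move: (4 * (gamma * L) * _) (36 * _ * _ * _ * _) (Y / _) => y1 y2 y3.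
clearbody x1 x2 x3 x4 x5 x6 m2 m3 m4 d.
move: rho1 rho2 rho3 rho4 => p1 p2 p3 p4.
move=> t1 t2 t3 h1 h2 h3 h4 h5 h6 m1r m2r m3r m4r m5r m6r m7r.
lra.
Qed.

End StepSize.
End RateBound.

(** * The convergence rate *)

Lemma ereal_gap_le (R : realType) (T : Type) (F : T -> R) (x0 : T) (Delta : R) :
  ((F x0)%:E - ereal_inf [set (F x)%:E | x in setT] <= Delta%:E)%E ->
  forall x, F x0 - F x <= Delta.
Proof.
move=> gap x.
have infF : (ereal_inf [set (F x)%:E | x in setT] <= (F x)%:E)%E.
  by apply: ereal_inf_lbound; exists x.
rewrite -lee_fin EFinB; apply: le_trans gap.
by rewrite leeB.
Qed.

Unset Implicit Arguments.

Theorem theorem2 (R : realType) :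
  exists C : R -> R -> R -> R,
  forall (n d K : nat) (W : 'M[R]_n) (pi : 'cV[R]_n) (L Delta sigma : R)
    (f : 'I_n -> 'rV[R]_d -> R) (x0 : 'rV[R]_d)
    (dT dX : measure_display) (T : measurableType dT) (P : probability T R)
    (X : 'I_n -> measurableType dX)
    (G : forall i : 'I_n, 'rV[R]_d -> X i -> 'rV[R]_d)
    (xi : forall i : 'I_n, nat -> {RV P >-> X i}),
  let g := fun (w : T) (k : nat) => stoch_grad G (fun i => xi i k w) in
  let beta := beta_pi W pi in
  let kappa := kappa_pi pi in
  let Y := fine ('E_P[fun w => sqnorm (g w 0%N (all_rows n x0))])%E in
  let gamma := step_size n K L Delta sigma beta kappa Y in
  let xbar := fun (k : nat) (w : T) =>
    row_mean (pd_x (push_diging W gamma x0 (g w) k)) in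
  nonnegative_mx W -> primitive_mx W -> column_stochastic W ->
  is_equilibrium W pi -> beta < 1 ->
  0 < L -> 0 < Delta -> 0 <= sigma -> (1 <= K)%N ->
  (forall i, lipschitz_gradient L (f i)) ->
  ((average f x0)%:E - ereal_inf [set (average f x)%:E | x in setT]
     <= Delta%:E)%E ->
  (forall i, measurable_oracle (G i)) ->
  (forall i k x j,
     ('E_P[fun w => (G i x (xi i k w) 0 j)%R] = (grad (f i) x 0 j)%:E)%E) ->
  (forall i k x,
     ('E_P[fun w => sqnorm (G i x (xi i k w) - grad (f i) x)%R]
        <= (sigma ^+ 2)%:E)%E) ->
  mutually_independent (I := ('I_n * nat)%type) (E := fun ik => X ik.1)
    (fun ik => xi ik.1 ik.2) ->
  ((K.+1%:R^-1)%:E *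
     \sum_(k < K.+1) 'E_P[fun w => (l2norm (grad (average f) (xbar k w)) ^+ 2)%R]
   <= (C L Delta Y * rate n K sigma beta kappa)%:E)%E.
Proof.
exists (fun L Delta Y => rate_constant L Delta Y).
move=> n d K W pi L Delta sigma f x0 dT dX T P X G xi g beta kappa Y gamma xbar.
move=> W_ge0 _ W_col W_pi beta_lt1 L0 Delta0 sigma0 K0 f_smooth gap G_meas.
move=> G_mean G_var indep.
have n0 := equilibrium_dim_gt0 W_pi.
have beta0 : 0 <= beta := beta_ge0 W pi.
have kappa1 : 1 <= kappa := kappa_ge1 W_pi.
have YE : Y = \int[P]_t sqnorm (pd_y (push_diging W gamma x0 (g t) 0)).
  by rewrite /Y expectationE.
have Y0 : 0 <= Y by rewrite YE; apply: Rintegral_ge0 => t _; exact: sqnorm_ge0.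
have gamma0 : 0 < gamma by exact: step_size_gt0.
have gammaL : gamma * L <= 1 / 2 by exact: step_size_L.
have gammab := step_size_beta n K Delta sigma Y L0 beta0 beta_lt1 kappa1.
have EE := expected_estimate G_meas G_mean G_var indep L0 f_smooth W_ge0 W_col W_pi
  beta_lt1 (ereal_gap_le gap) gamma0 gammaL gammab K.
(* Integrability identifies the extended real expectations of the statement with the real integrals
   of the estimate. *)
have IF (k : nat) : integ P (fun t => sqnorm (grad (average f) (xbar k t))).
  exact: (integ_grad_xbar G_meas G_mean G_var indep L0 f_smooth W gamma x0).
have -> : (\sum_(k < K.+1) 'E_P[fun w => (l2norm (grad (average f) (xbar k w)) ^+ 2)%R])%E
    = (\sum_(k < K.+1) \int[P]_t sqnorm (grad (average f) (xbar k t)))%:E.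
  rewrite -sumEFin; apply: eq_bigr => k _.
  rewrite expectationE Rintegral_fineK//; apply: eq_integral => t _.
  by rewrite l2norm_sqr.
rewrite -EFinM lee_fin.
have := rate_bound n0 K0 L0 Delta0 sigma0 beta0 beta_lt1 kappa1 Y0.
rewrite -/gamma; apply: le_trans.
have K1 : 0 < K.+1%:R :> R by rewrite ltr0n.
rewrite ler_pdivrMl//; apply: le_trans EE _; rewrite -YE -/beta -/kappa.
rewrite le_eqVlt; apply/orP; left; apply/eqP.
have b0 : 1 - beta != 0 by rewrite gt_eqF// subr_gt0.
move: gamma0 K1 n0; rewrite -(ltr0n R); move: (gamma) (K.+1%:R : R) (n%:R : R) (kappa).
move=> gam K1 N kap gam0 K10 N0; field.
by rewrite b0 !gt_eqF.
Qed.
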